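(* Let $\psi_m=\nu(\phi_p,\delta_q)\psi_q+\lambda(\phi_p)\psi_p$, with $\nu\in R[\xi_p,\xi_q]$ and $\lambda\in R[\xi_p]$, be a non-degenerate $\{\delta_p,\delta_q\}$-character of $\mathbb G_m$ over $R$, let $\mathcal K_+$ be its set of positive characteristic integers, and let $\mathcal U_1=\{u\in1+qR[[q]]:\psi_mu=0\}$. Then: 1) If $\mathcal K_+=\{\kappa\}$, then for any $q_0\in p^{n}R^\times$ with $n\ge1$ and any $g\in1+p^{\kappa n}R$ there exists a unique $u\in\mathcal U_1$ such that $u(q_0)=g$. 2) If $\mathcal K_+=\{1\}$, then for any $q_0\in pR^\times$ and any $g\in R^\times$ there exists a unique $u\in\mu(R)\cdot\mathcal U_1$ such that $u(q_0)=g$. Furthermore, $u(0)$ is the unique root of unity in $R$ that is congruent to $u(q_0)$ mod $p$.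
   Context: $p\ne 2$ is a prime, $R$ is the completion of the maximal unramified extension of $\mathbb Z_p$, $\phi:R\to R$ the unique automorphism lifting the $p$-power Frobenius on $k=R/pR$, $\mu(R)$ the group of roots of unity of $R$. On $R[[q]]$: $\phi_p(\sum a_nq^n)=\sum\phi(a_n)q^{pn}$, $\delta_pu=\frac{\phi_p(u)-u^p}{p}$, $\delta_q(\sum a_nq^n)=\sum na_nq^n$. For invertible $u$: $\psi_q(u)=\frac{\delta_qu}{u}$, $\psi_p(u)=\frac1p\log\frac{\phi_p(u)}{u^p}=\sum_{n\ge1}(-1)^{n-1}\frac{p^{n-1}}{n}\left(\frac{\delta_pu}{u^p}\right)^n$. For a polynomial $\nu=\sum\nu_{ij}\xi_p^i\xi_q^j$, $\nu(\phi_p,\delta_q)=\sum\nu_{ij}\phi_p^i\delta_q^j$. The characteristic polynomial of $\psi_m$ is $$\mu(\xi_p,\xi_q)=\nu(p\xi_p,\xi_q)\xi_q+\lambda(p\xi_p)(\xi_p-1).$$ $\psi_m$ is non-degenerate if $\mu(0,0)\in R^\times$ (equivalently $\lambda(0)\in R^\times$). A characteristic integer is $\kappa\in\mathbb Z$ with $\mu(0,\kappa)=0$ (such $\kappa$ is then prime to $p$). For $q_0\in pR$, $u(q_0)$ is the image of $u\in R[[q]]$ under the homomorphism $R[[q]]\to R$, $q\mapsto q_0$. *)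

(* Defs.v *)
From HB Require Import structures.
From mathcomp Require Import all_boot all_order all_algebra.
From mathcomp Require Import boolp classical_sets.

Set Implicit Arguments.
Unset Strict Implicit.
Unset Printing Implicit Defensive.

Import Order.TTheory GRing.Theory Num.Theory.
Local Open Scope ring_scope.

(** * The ring R[[q]] *)

Record fps (R : Type) := Fps { fcoef :> nat -> R }.

HB.instance Definition _ (R : Type) := gen_eqMixin (fps R).
HB.instance Definition _ (R : Type) := gen_choiceMixin (fps R).

Lemma fpsP (R : Type) (u v : fps R) : (forall n, u n = v n) -> u = v.
Proof. by case: u v => [u] [v] /= uv; congr Fps; apply/funext. Qed.

Section FpsRing.
Variable R : comNzRingType.
Implicit Types u v w : fps R.

Definition fpsC (c : R) : fps R := Fps (fun n => if n is 0 then c else 0).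
Definition fps_add u v : fps R := Fps (fun n => u n + v n).
Definition fps_opp u : fps R := Fps (fun n => - u n).
Definition fps_mul u v : fps R :=
  Fps (fun n => \sum_(i < n.+1) u i * v (n - i)%N).

Fact fps_addA : associative fps_add.
Proof. by move=> u v w; apply: fpsP => n /=; rewrite addrA. Qed.
Fact fps_addC : commutative fps_add.
Proof. by move=> u v; apply: fpsP => n /=; rewrite addrC. Qed.
Fact fps_add0 : left_id (fpsC 0) fps_add.
Proof. by move=> u; apply: fpsP => -[|n] /=; rewrite add0r. Qed.
Fact fps_addN : left_inverse (fpsC 0) fps_opp fps_add.
Proof. by move=> u; apply: fpsP => -[|n] /=; rewrite addNr. Qed.

HB.instance Definition _ := GRing.isZmodule.Build (fps R)
  fps_addA fps_addC fps_add0 fps_addN.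

Let trunc (N : nat) u : {poly R} := \poly_(i < N) u i.

Let fps_mulE (N n : nat) u v (P Q : {poly R}) : (n < N)%N ->
  (forall i, (i < N)%N -> P`_i = u i) -> (forall i, (i < N)%N -> Q`_i = v i) ->
  fps_mul u v n = (P * Q)`_n.
Proof.
move=> nN Pu Qv; rewrite coefM /=; apply: eq_bigr => i _.
rewrite Pu ?Qv //; first exact: leq_ltn_trans (leq_subr _ _) nN.
by apply: leq_ltn_trans nN; rewrite -ltnS.
Qed.

Let truncE N u i : (i < N)%N -> (trunc N u)`_i = u i.
Proof. by move=> iN; rewrite coef_poly iN. Qed.

Fact fps_mulC : commutative fps_mul.
Proof.
move=> u v; apply: fpsP => n.
rewrite (@fps_mulE n.+1 _ _ _ (trunc n.+1 u) (trunc n.+1 v)) //;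
  try by move=> i; apply: truncE.
by rewrite mulrC -(@fps_mulE n.+1 _ v u) // => i; apply: truncE.
Qed.

Fact fps_mulA : associative fps_mul.
Proof.
move=> u v w; apply: fpsP => n; set T := trunc n.+1.
have TE x i : (i < n.+1)%N -> (T x)`_i = x i by apply: truncE.
have TM x y i : (i < n.+1)%N -> (T x * T y)`_i = fps_mul x y i.
  by move=> iN; rewrite -(@fps_mulE n.+1 i x y) // => j; apply: TE.
rewrite (@fps_mulE n.+1 n u _ (T u) (T v * T w)) //;
  try by move=> i; first [apply: TE | apply: TM].
rewrite (@fps_mulE n.+1 n _ w (T u * T v) (T w)) ?mulrA //;
  by move=> i; first [apply: TM | apply: TE].
Qed.

Fact fps_mul1 : left_id (fpsC 1) fps_mul.
Proof.
move=> u; apply: fpsP => n /=; rewrite big_ord_recl subn0 mul1r big1 ?addr0 //.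
by move=> i _; rewrite mul0r.
Qed.

Fact fps_mulDl : left_distributive fps_mul fps_add.
Proof.
move=> u v w; apply: fpsP => n /=; rewrite -big_split /=.
by apply: eq_bigr => i _; rewrite mulrDl.
Qed.

Fact fps_oner_neq0 : fpsC 1 != 0.
Proof. by apply/eqP => /(congr1 (fun u : fps R => u 0)) /eqP; rewrite oner_eq0. Qed.

HB.instance Definition _ := GRing.Zmodule_isComNzRing.Build (fps R)
  fps_mulA fps_mulC fps_mul1 fps_mulDl fps_oner_neq0.

Definition fps_unit : {pred fps R} := fun u => `[< exists v, v * u = 1 >].
Definition fps_inv u : fps R := xget u [set v | v * u = 1].

Fact fps_mulV : {in fps_unit, left_inverse 1 fps_inv *%R}.
Proof. by move=> u /asboolP[v vu]; rewrite /fps_inv; case: xgetP => // /(_ v). Qed.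
Fact fps_unitPl u v : v * u = 1 -> fps_unit u.
Proof. by move=> vu; apply/asboolP; exists v. Qed.
Fact fps_inv_out : {in [predC fps_unit], fps_inv =1 id}.
Proof.
move=> u /negP nu; rewrite /fps_inv; case: xgetP => // v _ vu.
by case: nu; apply/asboolP; exists v.
Qed.

HB.instance Definition _ := GRing.ComNzRing_hasMulInverse.Build (fps R)
  fps_mulV fps_unitPl fps_inv_out.

End FpsRing.

(** * p-adic notions in a commutative ring *)

Section Padic.
Variables (p : nat) (A : comNzRingType).

Definition eqmodp (n : nat) (x y : A) : Prop := exists z, x - y = p%:R ^+ n * z.

Definition padic_cvg (a : nat -> A) (l : A) : Prop :=
  forall n, exists N, forall m, (N <= m)%N -> eqmodp n (a m) l.

(* Meaningful when the limit exists and A is p-adically separated. *)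
Definition padic_lim (a : nat -> A) : A := xget 0 [set l | padic_cvg a l].

Definition padic_separated : Prop :=
  forall x : A, (forall n, eqmodp n x 0) -> x = 0.

Definition padic_cauchy (a : nat -> A) : Prop :=
  forall n, exists N, forall m k, (N <= m)%N -> (N <= k)%N -> eqmodp n (a m) (a k).

Definition padic_complete : Prop :=
  forall a, padic_cauchy a -> exists l, padic_cvg a l.

End Padic.

(* The quotient x / y whenever y is not a zero divisor and divides x. *)
Definition exdiv (A : comNzRingType) (x y : A) : A := xget 0 [set z | z * y = x].

(** * The completion of the maximal unramified extension of Z_p *)

(* B is complete and f induces isomorphisms A / p^n A -> B / p^n B. *)
Definition is_padic_completion (p : nat) (A B : comNzRingType) (f : A -> B) : Prop :=
  [/\ padic_separated p B, padic_complete p B,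
      forall n x, eqmodp p n (f x) 0 -> eqmodp p n x 0 &
      forall n y, exists x, eqmodp p n y (f x)].

(* An integral extension of Z_p whose only maximal ideal is generated by p,
   i.e. the valuation ring of an unramified algebraic extension of Q_p; the
   residue extension is automatically separable, F_p being perfect. *)
Definition is_unramified_ext (p : nat) (Zp A : idomainType) (f : Zp -> A) : Prop :=
  [/\ injective f, integralRange f, p%:R \isn't a @GRing.unit A &
      forall x : A, ~ eqmodp p 1 x 0 -> x \is a GRing.unit].

Definition is_max_unramified_ext (p : nat) (Zp A : idomainType) (f : Zp -> A) : Prop :=
  is_unramified_ext p f /\
  forall (B : idomainType) (g : {rmorphism A -> B}),
    is_unramified_ext p (g \o f) -> bijective g.

Definition is_completed_max_unramified (p : nat) (R : idomainType) : Prop :=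
  exists (Zp A : idomainType) (f : {rmorphism Zp -> A}) (g : {rmorphism A -> R}),
    [/\ is_padic_completion p (intr : int -> Zp),
        is_max_unramified_ext p f & is_padic_completion p g].

Definition is_frobenius_lift (p : nat) (R : comNzRingType) (phi : R -> R) : Prop :=
  bijective phi /\ forall x, eqmodp p 1 (phi x) (x ^+ p).

(** * Operators on R[[q]] and characters of G_m *)

Section Characters.
Variables (p : nat) (R : idomainType) (phi : R -> R).
Implicit Types (u : fps R) (nu : {poly {poly R}}) (lam : {poly R}).

Definition fps_phip u : fps R :=
  Fps (fun n => if (p %| n)%N then phi (u (n %/ p)%N) else 0).

Definition fps_deltap u : fps R := exdiv (fps_phip u - u ^+ p) p%:R.

Definition fps_deltaq u : fps R := Fps (fun n => n%:R * u n).

Definition psi_q u : fps R := fps_deltaq u / u.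

Definition psi_p u : fps R :=
  padic_lim p (fun N => \sum_(1 <= n < N.+1)
    (-1) ^+ n.-1 * exdiv (p%:R ^+ n.-1) n%:R * (fps_deltap u / u ^+ p) ^+ n).

(* In {poly {poly R}}, the outer variable 'X is xi_p and the inner variable 'Y
   is xi_q, so nu`_i`_j is the coefficient of xi_p^i xi_q^j. *)
Definition op_nu nu u : fps R :=
  \sum_(i < size nu) \sum_(j < size nu`_i)
    fpsC nu`_i`_j * iter i fps_phip (iter j fps_deltaq u).

Definition op_lambda lam u : fps R :=
  \sum_(i < size lam) fpsC lam`_i * iter i fps_phip u.

Definition psi_m nu lam u : fps R := op_nu nu (psi_q u) + op_lambda lam (psi_p u).

Definition char_poly_m nu lam : {poly {poly R}} :=
  (nu \Po (p%:R * 'X)) * 'Y + (lam^:P \Po (p%:R * 'X)) * ('X - 1).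

Definition nondegenerate_char nu lam : Prop :=
  (char_poly_m nu lam).[0, 0] \is a GRing.unit.

Definition char_integers nu lam : set int :=
  [set k | (char_poly_m nu lam).[0, k%:~R] = 0]%classic.

Definition pos_char_integers nu lam : set int :=
  [set k | char_integers nu lam k /\ (0 < k)%R]%classic.

Definition U1 nu lam : set (fps R) :=
  [set u : fps R | u 0%N = 1 /\ psi_m nu lam u = 0]%classic.

Definition roots_of_unity : set R :=
  [set z : R | exists2 n, (0 < n)%N & n.-unity_root z]%classic.

Definition muU1 nu lam : set (fps R) :=
  [set u : fps R | exists z v, [/\ roots_of_unity z, U1 nu lam v & u = fpsC z * v]]%classic.

(* The image of u under R[[q]] -> R, q |-> q0, for q0 in pR. *)
Definition fps_eval u (q0 : R) : R :=
  padic_lim p (fun N => \sum_(i < N) u i * q0 ^+ i).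

End Characters.

(* Main.v *)
Require Import Defs.
From HB Require Import structures.
From mathcomp Require Import all_boot all_order all_algebra.
From mathcomp Require Import boolp classical_sets.
From mathcomp Require Import ring zify.

Set Implicit Arguments.
Unset Strict Implicit.
Unset Printing Implicit Defensive.

Import Order.TTheory GRing.Theory Num.Theory.
Local Open Scope ring_scope.

(* On 1 + qR[[q]] the logarithm psi_p is pinned down by psi_p(u)(0) = 0 and
   delta_q (psi_p u) = phi_p (psi_q u) - psi_q u, an identity without
   denominators.  It makes psi_p and psi_m homomorphisms, with
   psi_p (1 + c q^m + ...) = - c q^m + ... and
   psi_m (1 + c q^m + ...) = mu(0, m) c q^m + ...; the former makes
   psi_p : 1 + qR[[q]] -> qR[[q]] surjective, the latter makes u in U_1
   determined by its coefficient of q^kappa.  Conversely, in terms of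
   g = psi_p u the equation psi_m u = 0 is a triangular system in which
   g_kappa is free and the pivots mu(0, n), p | n, are units.  So
   u |-> u_kappa is an isomorphism from U_1 onto R.
   If u_kappa = p^k b, then u = v^(p^k) with v_kappa = b, hence
   u(q0) = 1 + p^(kappa n + k) c^kappa b modulo one more power of p when
   q0 = p^n c (p odd): the filtered homomorphism u |-> u(q0) is bijective onto
   1 + p^(kappa n) R.  Part 2 follows by splitting off Teichmuller
   representatives. *)

(** * Congruences modulo powers of p *)

(** The stage [F n] is a table filled below [n], with which all later stages agree there. As
    [step n] sees only earlier values, and [a0] elsewhere, power series can be built one coefficient
    at a time. *)
Lemma course_of_values_rec (T : Type) (step : nat -> (nat -> T) -> T) (a0 : T) :
  exists a, forall n, a n = step n (fun i => if (i < n)%N then a i else a0).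
Proof.
pose next n b i := if i == n then step n b else b i : T.
pose F := fix F n := if n is n'.+1 then next n' (F n') else (fun _ : nat => a0).
have Fge n i : (n <= i)%N -> F n i = a0.
  by elim: n => //= n IHn ni; rewrite /next gtn_eqF ?IHn // ltnW.
have Flt n i : (i < n)%N -> F n i = F i.+1 i.
  elim: n => // n IHn; rewrite ltnS leq_eqVlt => /orP[/eqP -> // | ilt].
  by rewrite -IHn //= /next ltn_eqF.
exists (fun n => F n.+1 n) => n; rewrite /= /next eqxx; congr step.
by apply/funext => i; case: ltnP => [/Flt //|/Fge].
Qed.

Section Congruence.
Variables (p : nat) (A : comNzRingType).
Implicit Types (x y z t : A) (n m k : nat).

Lemma eqmodp_refl n x : eqmodp p n x x.
Proof. by exists 0; rewrite subrr mulr0. Qed.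

Lemma eqmodp_sym n x y : eqmodp p n x y -> eqmodp p n y x.
Proof. by case=> z xy; exists (- z); rewrite mulrN -xy opprB. Qed.

Lemma eqmodp_trans n y x z : eqmodp p n x y -> eqmodp p n y z -> eqmodp p n x z.
Proof.
by case=> s xy [t yz]; exists (s + t); rewrite mulrDr -xy -yz addrA subrK.
Qed.

Lemma eqmodpD n x y z t :
  eqmodp p n x y -> eqmodp p n z t -> eqmodp p n (x + z) (y + t).
Proof. by case=> a xy [b zt]; exists (a + b); rewrite mulrDr -xy -zt; ring. Qed.

Lemma eqmodpN n x y : eqmodp p n x y -> eqmodp p n (- x) (- y).
Proof. by case=> a xy; exists (- a); rewrite mulrN -xy opprD. Qed.

Lemma eqmodpM n x y z t :
  eqmodp p n x y -> eqmodp p n z t -> eqmodp p n (x * z) (y * t).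
Proof.
case=> a xy [b zt]; exists (a * z + y * b).
by rewrite mulrDr mulrA -xy mulrCA -zt; ring.
Qed.

Lemma eqmodpMl n x y z : eqmodp p n y z -> eqmodp p n (x * y) (x * z).
Proof. by move=> yz; apply: eqmodpM => //; apply: eqmodp_refl. Qed.

Lemma eqmodpX n x y k : eqmodp p n x y -> eqmodp p n (x ^+ k) (y ^+ k).
Proof.
move=> xy; elim: k => [|k IHk]; first exact: eqmodp_refl.
by rewrite !exprS; apply: eqmodpM.
Qed.

Lemma eqmodp_sum n (I : Type) (r : seq I) (P : pred I) (F G : I -> A) :
  (forall i, P i -> eqmodp p n (F i) (G i)) ->
  eqmodp p n (\sum_(i <- r | P i) F i) (\sum_(i <- r | P i) G i).
Proof.
move=> FG; elim/big_rec2: _ => [|i x y Pi]; first exact: eqmodp_refl.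
by apply: eqmodpD; apply: FG.
Qed.

Lemma eqmodp_leq n m x y : (m <= n)%N -> eqmodp p n x y -> eqmodp p m x y.
Proof.
move=> mn [z xy]; exists (p%:R ^+ (n - m) * z).
by rewrite mulrA -exprD subnKC.
Qed.

Lemma eqmodp_mulX n z : eqmodp p n (p%:R ^+ n * z) 0.
Proof. by exists z; rewrite subr0. Qed.

Lemma eqmodp_subr0 n x y : eqmodp p n (x - y) 0 = eqmodp p n x y.
Proof. by rewrite /eqmodp subr0. Qed.

Lemma eqmodp_rmorph (B : comNzRingType) (f : {rmorphism A -> B}) n x y :
  eqmodp p n x y -> eqmodp p n (f x) (f y).
Proof.
by case=> z xy; exists (f z); rewrite -rmorphB xy rmorphM rmorphXn rmorph_nat.
Qed.

Lemma padic_cvg_unique (a : nat -> A) l1 l2 :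
  padic_separated p A -> padic_cvg p a l1 -> padic_cvg p a l2 -> l1 = l2.
Proof.
move=> sep a1 a2; apply/eqP; rewrite -subr_eq0; apply/eqP/sep => n.
have [N1 H1] := a1 n; have [N2 H2] := a2 n; rewrite eqmodp_subr0.
apply: eqmodp_trans (eqmodp_sym (H1 (maxn N1 N2) (leq_maxl _ _))) _.
exact: H2 (leq_maxr _ _).
Qed.

Lemma padic_lim_cvg (a : nat -> A) :
  (exists l, padic_cvg p a l) -> padic_cvg p a (padic_lim p a).
Proof.
by case=> l al; apply: (@xgetPex _ 0 [set l | padic_cvg p a l]%classic); exists l.
Qed.

Lemma padic_limE (a : nat -> A) l :
  padic_separated p A -> padic_cvg p a l -> padic_lim p a = l.
Proof.
by move=> sep al; apply: (padic_cvg_unique sep _ al); apply: padic_lim_cvg; exists l.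
Qed.

Lemma eqmodp_telescope (a : nat -> A) n N :
  (forall m, (N <= m)%N -> eqmodp p n (a m.+1) (a m)) ->
  forall m, (N <= m)%N -> eqmodp p n (a m) (a N).
Proof.
move=> aS m /subnK <-; elim: (m - N)%N => [|k IHk]; first exact: eqmodp_refl.
by rewrite addSn; apply: eqmodp_trans IHk; apply: aS; rewrite leq_addl.
Qed.

Lemma padic_cauchyS (a : nat -> A) :
  (forall n, exists N, forall m, (N <= m)%N -> eqmodp p n (a m.+1) (a m)) ->
  padic_cauchy p a.
Proof.
move=> aS n; have [N /eqmodp_telescope aN] := aS n; exists N => m k Nm Nk.
by apply: eqmodp_trans (aN _ Nm) _; apply/eqmodp_sym/aN.
Qed.

Lemma exprD_order2 x t k :
  exists s, (x + t) ^+ k.+1 = x ^+ k.+1 + k.+1%:R * x ^+ k * t + t ^+ 2 * s.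
Proof.
elim: k => [|k [s IHk]]; first by exists 0; ring.
by exists (s * (x + t) + k.+1%:R * x ^+ k);
  rewrite exprS IHk -[k.+2%:R]natr1 !exprS; ring.
Qed.

Lemma expr1D_order3 t k :
  exists s, (1 + t) ^+ k = 1 + k%:R * t + 'C(k, 2)%:R * t ^+ 2 + t ^+ 3 * s.
Proof.
elim: k => [|k [s IHk]]; first by exists 0; rewrite bin0n /=; ring.
exists (s * (1 + t) + 'C(k, 2)%:R).
by rewrite exprS IHk binS bin1 natrD -[k.+1%:R]natr1; ring.
Qed.

(** With x = y + p^n z, the linear term of x^p carries p^(n+1) and the remainder carries p^(2n),
    where 2n >= n + 1. *)
Lemma eqmodp_expp n x y : (0 < p)%N -> (0 < n)%N ->
  eqmodp p n x y -> eqmodp p n.+1 (x ^+ p) (y ^+ p).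
Proof.
case: n => // n p0 _ [z /eqP]; rewrite subr_eq addrC => /eqP ->.
have [s] := exprD_order2 y (p%:R ^+ n.+1 * z) p.-1; rewrite prednK // => ->.
exists (y ^+ p.-1 * z + p%:R ^+ n * z ^+ 2 * s).
by move: (y ^+ p.-1) (y ^+ p) => a b; rewrite !exprS; ring.
Qed.

Lemma eqmodp_exppn n x y k : (0 < p)%N -> (0 < n)%N ->
  eqmodp p n x y -> eqmodp p (n + k)%N (x ^+ (p ^ k)) (y ^+ (p ^ k)).
Proof.
move=> p0 n0 xy; elim: k => [|k IHk]; first by rewrite addn0.
by rewrite addnS expnSr !exprM; apply: eqmodp_expp => //; rewrite addn_gt0 n0.
Qed.

(** For odd p the binomial coefficient of the quadratic term gives an extra factor p. That term then
    lies in p^(2n+1) and the remainder in p^(3n); both exponents are at least n + 2. *)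
Lemma eqmodp_expp1D n z : prime p -> p <> 2%N -> (0 < n)%N ->
  eqmodp p n.+2 ((1 + p%:R ^+ n * z) ^+ p) (1 + p%:R ^+ n.+1 * z).
Proof.
case: n => // n p_pr p2 _; have [s ->] := expr1D_order3 (p%:R ^+ n.+1 * z) p.
have /dvdnP[c ->] : (p %| 'C(p, 2))%N.
  by apply: prime_dvd_bin => //=; have := prime_gt1 p_pr; lia.
exists (c%:R * p%:R ^+ n * z ^+ 2 + p%:R ^+ n * p%:R ^+ n * z ^+ 3 * s).
by rewrite natrM !exprS; ring.
Qed.

Lemma exprD_prime x y : prime p -> eqmodp p 1 ((x + y) ^+ p) (x ^+ p + y ^+ p).
Proof.
move=> p_pr; rewrite exprDn.
have: eqmodp p 1 (\sum_(i < p.+1) x ^+ (p - i) * y ^+ i *+ 'C(p, i))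
  (\sum_(i < p.+1) if (i : nat) == 0%N then x ^+ p
     else if (i : nat) == p then y ^+ p else 0).
  apply: eqmodp_sum => i _; case: eqP => [->|/eqP i0].
    by rewrite subn0 bin0 mulr1; apply: eqmodp_refl.
  case: eqP => [->|/eqP ip].
    by rewrite subnn binn mul1r; apply: eqmodp_refl.
  have /dvdnP[c ->] : (p %| 'C(p, i))%N.
    by apply: prime_dvd_bin => //; have := ltn_ord i; lia.
  by exists (x ^+ (p - i) * y ^+ i * c%:R); rewrite -mulr_natr natrM; ring.
move/eqmodp_trans; apply.
have p0 := prime_gt0 p_pr.
rewrite -(big_mkord xpredT (fun i => if i == 0%N then x ^+ p
  else if i == p then y ^+ p else 0)).
rewrite big_nat_recr //= eqxx gtn_eqF // big_ltn //= big_nat_cond big1 ?addr0.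
  exact: eqmodp_refl.
by move=> i /andP[/andP[i0 ip] _]; rewrite gtn_eqF // ltn_eqF.
Qed.

End Congruence.

(** * Power series and the operators phi_p, delta_q *)

Section PowerSeries.
Variable A : comNzRingType.
Implicit Types (u v w : fps A) (n m k N : nat).

Lemma fps_coef0 n : (0 : fps A) n = 0. Proof. by case: n. Qed.

Lemma fps_coef1 n : (1 : fps A) n = (n == 0%N)%:R. Proof. by case: n. Qed.

Definition fps_nth n u := u n.

Fact fps_nth_is_zmod_morphism n : zmod_morphism (fps_nth n).
Proof. by []. Qed.

HB.instance Definition _ n :=
  GRing.isZmodMorphism.Build (fps A) A (fps_nth n) (fps_nth_is_zmod_morphism n).

Lemma fps_coefD u v n : (u + v) n = u n + v n. Proof. by []. Qed.

Lemma fps_coefB u v n : (u - v) n = u n - v n. Proof. by []. Qed.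

Lemma fps_coef_sum (I : Type) (r : seq I) (P : pred I) (F : I -> fps A) n :
  (\sum_(i <- r | P i) F i) n = \sum_(i <- r | P i) F i n.
Proof. exact: (raddf_sum (fps_nth n)). Qed.

Lemma fps_coefMn u k n : (u *+ k) n = u n *+ k.
Proof. exact: (raddfMn (fps_nth n)). Qed.

Lemma fps_coef_natM u k n : (k%:R * u) n = k%:R * u n.
Proof. by rewrite !mulr_natl fps_coefMn. Qed.

Lemma fps_coefCM c u n : (fpsC c * u) n = c * u n.
Proof.
rewrite /= big_ord_recl subn0 big1 ?addr0 // => i _; exact: mul0r.
Qed.

Lemma fps_coefM0 u v : (u * v) 0%N = u 0%N * v 0%N.
Proof. by rewrite /= big_ord_recl big_ord0 addr0. Qed.

Lemma fps_coefX0 u n : (u ^+ n) 0%N = u 0%N ^+ n.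
Proof. by elim: n => // n IHn; rewrite !exprS fps_coefM0 IHn. Qed.

Lemma fps_coefM_ends u v n : (0 < n)%N ->
  (forall i, (0 < i < n)%N -> u i * v (n - i)%N = 0) ->
  (u * v) n = u 0%N * v n + u n * v 0%N.
Proof.
case: n => // n _ uv0; rewrite /= big_ord_recl big_ord_recr /= subn0 big1.
  by rewrite add0r /bump add1n subnn.
by move=> i _; apply: uv0; rewrite /= /bump; have := ltn_ord i; lia.
Qed.

Lemma fps_inv_exists u : u 0%N = 1 -> u \is a GRing.unit.
Proof.
move=> u0; pose step n (b : nat -> A) : A :=
  if n == 0%N then 1 else - \sum_(i < n) b i * u (n - i)%N.
have [a aE] := course_of_values_rec step 0.
apply/asboolP; exists (Fps a); apply: fpsP => -[|n].
  by rewrite fps_coefM0 u0 /= aE mulr1.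
rewrite /= big_ord_recr /= subnn u0 mulr1 [a n.+1]aE /step /=.
rewrite [X in X - _](eq_bigr (fun i : 'I_n.+1 =>
  (if (i < n.+1)%N then a i else 0) * u (n.+1 - i)%N)) ?subrr //.
by move=> i _; rewrite ltn_ord.
Qed.

Lemma fps_coefV0 u : u 0%N = 1 -> u^-1 0%N = 1.
Proof.
move=> u0; have /(congr1 (fun w : fps A => w 0%N)) := mulVr (fps_inv_exists u0).
by rewrite fps_coefM0 u0 mulr1.
Qed.

Lemma fpsCM (c d : A) : fpsC (c * d) = fpsC c * fpsC d.
Proof. by apply: fpsP => n; rewrite fps_coefCM; case: n => //= _; rewrite mulr0. Qed.

Lemma fpsCX (c : A) n : fpsC (c ^+ n) = fpsC c ^+ n.
Proof. by elim: n => // n IHn; rewrite !exprS fpsCM IHn. Qed.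

Definition fpsX : fps A := Fps (fun n => (n == 1%N)%:R).

Lemma fps_coefXM u n : (fpsX * u) n = if n is m.+1 then u m else 0.
Proof.
case: n => [|n]; first by rewrite fps_coefM0 mul0r.
rewrite /= !big_ord_recl /= mul0r add0r mul1r subSS subn0 big1 ?addr0 // => i _.
by rewrite mul0r.
Qed.

Lemma fps_coefXnM k u n : (fpsX ^+ k * u) n = if (n < k)%N then 0 else u (n - k)%N.
Proof.
elim: k n => [|k IHk] n; first by rewrite mul1r subn0.
by rewrite exprS -mulrA fps_coefXM; case: n => // n; rewrite IHk.
Qed.

Lemma fps_recl u : u = fpsC (u 0%N) + fpsX * Fps (fun n => u n.+1).
Proof.
by apply: fpsP => n; rewrite fps_coefD fps_coefXM; case: n => *; rewrite ?addr0 ?add0r.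
Qed.

Definition fps_trunc N u : {poly A} := \poly_(i < N) u i.

Lemma coef_fps_trunc N u i : (i < N)%N -> (fps_trunc N u)`_i = u i.
Proof. by move=> iN; rewrite coef_poly iN. Qed.

(** Truncation turns statements about finitely many coefficients of a product into identities
    between polynomials. *)
Lemma fps_coefM_poly N n u v (P Q : {poly A}) : (n < N)%N ->
  (forall i, (i < N)%N -> P`_i = u i) -> (forall i, (i < N)%N -> Q`_i = v i) ->
  (u * v) n = (P * Q)`_n.
Proof.
move=> nN Pu Qv; rewrite coefM /=; apply: eq_bigr => i _.
rewrite Pu ?Qv //; first exact: leq_ltn_trans (leq_subr _ _) nN.
by apply: leq_ltn_trans nN; rewrite -ltnS.
Qed.

Lemma fps_natr_torsionfree k u v : (forall x y : A, k%:R * x = k%:R * y -> x = y) ->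
  k%:R * u = k%:R * v -> u = v.
Proof.
move=> reg uv; apply: fpsP => n; apply: reg.
by rewrite -!fps_coef_natM uv.
Qed.

Lemma fps_eqmodpP (p : nat) n u v :
  (forall i, eqmodp p n (u i) (v i)) <-> eqmodp p n u v.
Proof.
split=> [/choice[z zE] | [z uvz] i]; last first.
  by exists (z i); rewrite -fps_coefB uvz -natrX fps_coef_natM natrX.
by exists (Fps z); apply: fpsP => i; rewrite -natrX fps_coef_natM natrX -zE.
Qed.

Lemma fps_padic_separated (p : nat) : padic_separated p A -> padic_separated p (fps A).
Proof.
move=> sep u u0; apply: fpsP => i; rewrite fps_coef0; apply: sep => n.
by have /fps_eqmodpP/(_ i) := u0 n; rewrite fps_coef0.
Qed.

Lemma fps_padic_complete (p : nat) : padic_complete p A -> padic_complete p (fps A).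
Proof.
move=> compl a a_cauchy.
have a_cvg i : exists l, padic_cvg p (fun m => a m i) l.
  apply: compl => n; have [N aN] := a_cauchy n; exists N => m k mN kN.
  by move/fps_eqmodpP: (aN _ _ mN kN); apply.
have [l al] := choice a_cvg; exists (Fps l) => n.
have [N aN] := a_cauchy n; exists N => m mN; apply/fps_eqmodpP => i /=.
(* [M] depends on [i] but [N] does not: passing through a term beyond both gives a bound that is
   uniform in the coefficients. *)
have [M aM] := al i n; apply: eqmodp_trans (aM _ (leq_maxr N M)).
by move/fps_eqmodpP: (aN _ _ mN (leq_maxl N M)); apply.
Qed.

End PowerSeries.

Section Operators.
Variables (p : nat) (R : idomainType) (phi : {rmorphism R -> R}).
Hypothesis p_prime : prime p.
Implicit Types (u v w : fps R) (n m k N : nat).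
Let p_gt0 : (0 < p)%N := prime_gt0 p_prime.

Local Notation phip := (fps_phip p phi).
Local Notation deltaq := (@fps_deltaq R).

Lemma fps_phip_is_zmod_morphism : zmod_morphism phip.
Proof.
by move=> u v; apply: fpsP => n /=; case: ifP => _; rewrite ?rmorphB ?subr0.
Qed.

Lemma fps_deltaq_is_zmod_morphism : zmod_morphism deltaq.
Proof. by move=> u v; apply: fpsP => n /=; rewrite mulrBr. Qed.

HB.instance Definition _ :=
  GRing.isZmodMorphism.Build (fps R) (fps R) phip fps_phip_is_zmod_morphism.
HB.instance Definition _ :=
  GRing.isZmodMorphism.Build (fps R) (fps R) deltaq fps_deltaq_is_zmod_morphism.

Lemma fps_phipD u v : phip (u + v) = phip u + phip v.
Proof. exact: (raddfD phip). Qed.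

Lemma fps_deltaqD u v : deltaq (u + v) = deltaq u + deltaq v.
Proof. exact: (raddfD deltaq). Qed.

Lemma fps_phipB u v : phip (u - v) = phip u - phip v.
Proof. exact: (raddfB phip). Qed.

Lemma fps_deltaqB u v : deltaq (u - v) = deltaq u - deltaq v.
Proof. exact: (raddfB deltaq). Qed.

(** On truncations [phip] applies [phi] to the coefficients and substitutes X^p; both operations are
    multiplicative on polynomials, whence [fps_phipM]. *)
Lemma fps_coef_phip_poly N n u (P : {poly R}) : (n < N)%N ->
  (forall i, (i < N)%N -> P`_i = u i) -> (map_poly phi P \Po 'X^p)`_n = phip u n.
Proof.
move=> nN Pu; rewrite coef_comp_poly_Xn //=; case: ifP => // _.
by rewrite coef_map Pu // (leq_ltn_trans (leq_div _ _)).
Qed.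

Lemma fps_phipM u v : phip (u * v) = phip u * phip v.
Proof.
apply: fpsP => n; pose P := fps_trunc n.+1 u; pose Q := fps_trunc n.+1 v.
have PE i : (i < n.+1)%N -> P`_i = u i by apply: coef_fps_trunc.
have QE i : (i < n.+1)%N -> Q`_i = v i by apply: coef_fps_trunc.
rewrite (@fps_coefM_poly _ n.+1 n (phip u) (phip v)
  (map_poly phi P \Po 'X^p) (map_poly phi Q \Po 'X^p)) //;
  try by move=> i iN; apply: (@fps_coef_phip_poly n.+1).
rewrite -comp_polyM -rmorphM; symmetry.
apply: (@fps_coef_phip_poly n.+1) => // i iN.
by rewrite (@fps_coefM_poly _ n.+1 i u v P Q).
Qed.

Lemma fps_phipX : phip (fpsX R) = fpsX R ^+ p.
Proof.
apply: fpsP => n; rewrite -[fpsX R ^+ p]mulr1 fps_coefXnM fps_coef1 /=.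
have [np | pn] := ltnP n p.
  by case: ifP => // _; rewrite divn_small // rmorph0.
rewrite subn_eq0 leq_eqVlt ltnNge pn orbF.
case: ifP => [/dvdnP[m nE]|].
  rewrite nE mulnK // -{2}(mul1n p) eqn_pmul2r //.
  by case: eqP => _; rewrite ?rmorph1 ?rmorph0.
by case: eqP => // ->; rewrite dvdnn.
Qed.

(** Write u = u(0) + q v. Modulo p, u^p is u(0)^p + q^p v^p, while phi_p(u) is phi(u(0)) + q^p
    phi_p(v); the shift by q^p allows induction on the index. This congruence gives delta_p its
    meaning. *)
Lemma fps_phip_frobenius u : (forall x, eqmodp p 1 (phi x) (x ^+ p)) ->
  eqmodp p 1 (phip u) (u ^+ p).
Proof.
move=> frob; apply/fps_eqmodpP => n; elim/ltn_ind: n u => n IHn u.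
rewrite (fps_recl u); set v := Fps _.
rewrite fps_phipD fps_phipM fps_phipX.
have /fps_eqmodpP/(_ n) := exprD_prime (fpsC (u 0%N)) (fpsX R * v) p_prime.
move/eqmodp_sym; apply: eqmodp_trans; rewrite exprMn -fpsCX.
apply: eqmodpD; last first.
  rewrite !fps_coefXnM; case: ltnP => // pn; first exact: eqmodp_refl.
  by apply: IHn; lia.
case: n {IHn} => [|n] /=; first by rewrite dvdn0 div0n; apply: frob.
case: ifP => [/divnK|_]; last exact: eqmodp_refl.
by case: (n.+1 %/ p)%N => [|m] // _ /=; rewrite rmorph0; apply: eqmodp_refl.
Qed.

Lemma fps_deltaqM u v : deltaq (u * v) = deltaq u * v + u * deltaq v.
Proof.
apply: fpsP => n /=; rewrite mulr_sumr -big_split /=; apply: eq_bigr => i _.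
by rewrite -{1}(subnK (ltn_ord i : (i <= n)%N)) natrD; ring.
Qed.

Lemma fps_deltaq1 : deltaq 1 = 0.
Proof. by apply: fpsP => -[|n]; rewrite /= ?mul0r ?mulr0. Qed.

Lemma fps_deltaq_natM k u : deltaq (k%:R * u) = k%:R * deltaq u.
Proof. by rewrite !mulr_natl (raddfMn deltaq). Qed.

Lemma fps_deltaqX u n : deltaq (u ^+ n) = n%:R * u ^+ n.-1 * deltaq u.
Proof.
elim: n => [|n IHn]; first by rewrite fps_deltaq1 !mul0r.
rewrite exprS fps_deltaqM IHn -natr1.
case: n {IHn} => [|n]; first by rewrite !expr0; ring.
by rewrite exprS /=; ring.
Qed.

(** Chain rule for the substitution of q^p for q: n = p (n / p) at the indices that survive. *)
Lemma fps_deltaq_phip u : deltaq (phip u) = p%:R * phip (deltaq u).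
Proof.
apply: fpsP => n; rewrite fps_coef_natM /=; case: ifP => pn; last by rewrite !mulr0.
by rewrite rmorphM rmorph_nat mulrA -natrM mulnC divnK.
Qed.

End Operators.

(** * The logarithmic series of psi_p *)

(** With v = [logn p n], one has 2v < p^v <= n. Hence p^(n-1) / n is p-integral and tends to 0
    p-adically. *)
Lemma logn_double_lt (p n : nat) : (2 < p)%N -> (0 < n)%N -> (2 * logn p n < n)%N.
Proof.
move=> p2 n0; apply: (@leq_trans (p ^ logn p n)).
  elim: (logn p n) => // v IHv; rewrite expnS.
  have := expn_gt0 p v; nia.
exact: dvdn_leq (pfactor_dvdnn p n).
Qed.

Section LogarithmicSeries.
Variables (p : nat) (R : idomainType) (phi : {rmorphism R -> R}).
Hypotheses (p_prime : prime p) (p_gt2 : (2 < p)%N).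
Hypotheses (R_sep : padic_separated p R) (R_compl : padic_complete p R).
Hypothesis R_char0 : forall n, (0 < n)%N -> n%:R != 0 :> R.
Hypothesis R_coprime_unit : forall t, coprime p t -> t%:R \is a @GRing.unit R.
Hypothesis phi_frob : forall x, eqmodp p 1 (phi x) (x ^+ p).
Implicit Types (u v w : fps R) (n m k N : nat).
Let p_gt0 : (0 < p)%N := prime_gt0 p_prime.

Local Notation phip := (fps_phip p phi).
Local Notation deltaq := (@fps_deltaq R).

Lemma fps_natM_inj k u v : (0 < k)%N -> k%:R * u = k%:R * v -> u = v.
Proof.
by move=> k0; apply: fps_natr_torsionfree; apply: mulfI; apply: R_char0.
Qed.

Lemma exdivE u w k : (0 < k)%N -> w * k%:R = u -> exdiv u k%:R = w.
Proof.
move=> k0 wu; apply: (@fps_natM_inj k) => //; rewrite -!(mulrC _ k%:R) wu.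
by apply: (@xgetPex _ 0 [set z | z * k%:R = u]%classic); exists w.
Qed.

Lemma fps_deltapE u : phip u = u ^+ p + p%:R * fps_deltap p phi u.
Proof.
have [z] := fps_phip_frobenius p_prime u phi_frob; rewrite expr1 => zE.
by rewrite /fps_deltap zE (exdivE p_gt0 (mulrC z _)) -zE addrC subrK.
Qed.

Definition log_coef n : fps R := exdiv (p%:R ^+ n.-1) n%:R.

(** Write n = t p^v with t prime to p, hence invertible: the quotient is the constant p^(n-1-v) /
    t. *)
Lemma log_coefP n : (0 < n)%N ->
  [/\ log_coef n * n%:R = p%:R ^+ n.-1, deltaq (log_coef n) = 0
    & eqmodp p (n.-1 - logn p n) (log_coef n) 0].
Proof.
move=> n0; have [t cpt nE] := pfactor_coprime p_prime n0.
set v := logn p n in nE *; have vn : (v <= n.-1)%N.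
  by have := logn_double_lt p_gt2 n0; rewrite -/v; lia.
have tV : fpsC t%:R^-1 * t%:R = 1 :> fps R.
  apply: fpsP => i; rewrite mulrC fps_coef_natM fps_coef1.
  by case: i => [|i] /=; rewrite ?mulr0 ?mulrV ?R_coprime_unit.
have zE : p%:R ^+ (n.-1 - v) * fpsC t%:R^-1 * n%:R = p%:R ^+ n.-1 :> fps R.
  rewrite nE natrM natrX mulrA -(mulrA _ _ t%:R) tV mulr1 -exprD -nE.
  by rewrite subnK.
rewrite /log_coef (exdivE n0 zE); split=> //; last exact: eqmodp_mulX.
rewrite -natrX fps_deltaq_natM (_ : deltaq (fpsC _) = 0) ?mulr0 //.
by apply: fpsP => -[|i] /=; rewrite ?mul0r ?mulr0.
Qed.

Lemma fps_deltaq_eqmodp n u v :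
  eqmodp p n u v -> eqmodp p n (deltaq u) (deltaq v).
Proof.
case=> z uv; exists (deltaq z).
by rewrite -fps_deltaqB uv -natrX fps_deltaq_natM.
Qed.

Definition log_sum w N : fps R :=
  \sum_(1 <= n < N.+1) (-1) ^+ n.-1 * log_coef n * w ^+ n.

Lemma log_sumS w N :
  log_sum w N.+1 = log_sum w N + (-1) ^+ N * log_coef N.+1 * w ^+ N.+1.
Proof. by rewrite /log_sum big_nat_recr. Qed.

Lemma log_sum_cvg w : padic_cvg p (log_sum w) (padic_lim p (log_sum w)).
Proof.
apply/padic_lim_cvg/(fps_padic_complete R_compl)/padic_cauchyS => n.
(* For N >= 2n the new term is divisible by p to the power N - [logn p N.+1], which is at least
   n. *)
exists (2 * n)%N => N nN; rewrite log_sumS -eqmodp_subr0 addrC addKr.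
have [_ _ e0] := log_coefP (ltn0Sn N).
rewrite mulrAC; apply: (@eqmodp_trans _ _ _ ((-1) ^+ N * w ^+ N.+1 * 0)).
  apply: eqmodpMl; apply: eqmodp_leq e0.
  by have := logn_double_lt p_gt2 (ltn0Sn N); rewrite -pred_Sn; lia.
by rewrite mulr0; apply: eqmodp_refl.
Qed.

(** Differentiation cancels the denominators n and turns the partial sums of the logarithm into
    those of the geometric series of ratio -p w. *)
Lemma fps_deltaq_log_sum w N :
  (1 + p%:R * w) * deltaq (log_sum w N) = deltaq w * (1 - (- (p%:R * w)) ^+ N).
Proof.
have d1 : deltaq (- 1) = 0.
  by rewrite -sub0r fps_deltaqB fps_deltaq1 subr0; apply: (raddf0 deltaq).
elim: N => [|N IHN].
  by rewrite /log_sum big_geq // expr0 subrr (raddf0 deltaq) !mulr0.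
rewrite log_sumS fps_deltaqD mulrDr IHN.
have [eN de _] := log_coefP (ltn0Sn N).
rewrite !fps_deltaqM !fps_deltaqX de d1 /=.
rewrite !(mulr0, mul0r, addr0, add0r).
transitivity (deltaq w * (1 - (- (p%:R * w)) ^+ N) +
  (1 + p%:R * w) * ((-1) ^+ N * (log_coef N.+1 * N.+1%:R) * w ^+ N * deltaq w)).
  by congr (_ + _); ring.
by rewrite eN /= -[- (_ * _)]mulN1r !exprMn !exprS; ring.
Qed.

Lemma fps_deltaq_log w :
  (1 + p%:R * w) * deltaq (padic_lim p (log_sum w)) = deltaq w.
Proof.
apply/eqP; rewrite -subr_eq0; apply/eqP/(fps_padic_separated R_sep) => n.
rewrite eqmodp_subr0; have [N0 /(_ _ (leq_maxl N0 n)) cvgN] := log_sum_cvg w n.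
set N := maxn N0 n in cvgN.
have nN : (n <= N)%N by apply: leq_maxr.
apply: (@eqmodp_trans _ _ _ ((1 + p%:R * w) * deltaq (log_sum w N))).
  by apply/eqmodpMl/fps_deltaq_eqmodp/eqmodp_sym.
rewrite fps_deltaq_log_sum -[X in eqmodp _ _ _ X]mulr1; apply: eqmodpMl.
rewrite -[X in eqmodp _ _ _ X]subr0; apply: eqmodpD; first exact: eqmodp_refl.
apply/eqmodpN/(eqmodp_leq nN); rewrite -mulrN exprMn; exact: eqmodp_mulX.
Qed.

(** Apply delta_q to phi_p(u) = (1 + p w) u^p, with the chain rule on the left and the derivative of
    the logarithm on the right. The two sides are compared after multiplication by p phi_p(u), which
    can be cancelled. *)
Lemma fps_deltaq_psi_p u : u 0%N = 1 ->
  deltaq (psi_p p phi u) = phip (psi_q u) - psi_q u.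
Proof.
move=> u0; have uU := fps_inv_exists u0.
set h := psi_q u; set w := fps_deltap p phi u / u ^+ p.
have duE : deltaq u = h * u by rewrite /h /psi_q divrK.
set S := psi_p p phi u; have SE : (1 + p%:R * w) * deltaq S = deltaq w.
  exact: fps_deltaq_log.
have yE : (1 + p%:R * w) * u ^+ p = phip u.
  by rewrite mulrDl mul1r -mulrA divrK ?unitrX // -fps_deltapE.
have phU : phip u \is a GRing.unit.
  by apply: fps_inv_exists; rewrite /= dvdn0 div0n u0 rmorph1.
apply: (mulrI phU); apply: (@fps_natM_inj p) => //.
have := fps_deltaq_phip p phi u.
rewrite duE fps_phipM // -{1}yE fps_deltaqM fps_deltaqX fps_deltaqD fps_deltaq1.
rewrite fps_deltaq_natM add0r -SE duE => E.
transitivity (p%:R * ((1 + p%:R * w) * u ^+ p) * deltaq S); first by rewrite yE mulrA.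
rewrite mulrBr mulrBr (mulrC (phip u)) -E -yE.
have -> : u ^+ p = u ^+ p.-1 * u by rewrite -exprSr prednK.
by ring.
Qed.

(** Since phi(1) = 1 = 1^p, the series [w] has no constant term, and neither has any partial sum of
    the logarithm. *)
Lemma psi_p_coef0 u : u 0%N = 1 -> psi_p p phi u 0%N = 0.
Proof.
move=> u0; set w := fps_deltap p phi u / u ^+ p.
have w0 : w 0%N = 0.
  rewrite /w fps_coefM0; apply/eqP; rewrite mulf_eq0; apply/orP; left.
  have /(congr1 (fun v : fps R => v 0%N)) := fps_deltapE u.
  rewrite fps_coefD fps_coefX0 fps_coef_natM /= dvdn0 div0n u0 rmorph1 expr1n.
  move/eqP; rewrite -subr_eq0 opprD addNKr oppr_eq0 mulf_eq0.
  by rewrite (negPf (R_char0 p_gt0)).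
apply: R_sep => n; have [N /(_ _ (leqnn N)) /fps_eqmodpP/(_ 0%N)] := log_sum_cvg w n.
move/eqmodp_sym/eqmodp_trans; apply.
rewrite /log_sum fps_coef_sum big_nat_cond big1; first exact: eqmodp_refl.
move=> i /andP[/andP[i0 _] _]; rewrite fps_coefM0 fps_coefX0 w0 expr0n.
by rewrite gtn_eqF // mulr0.
Qed.

End LogarithmicSeries.

(** * The kernel of a character *)

(* [psip] stands for [psi_p], of which only the two properties below matter;
   keeping it abstract also protects conversion from unfolding p-adic limits. *)
Section CharacterKernel.
Variables (p : nat) (R : idomainType) (phi : {rmorphism R -> R}).
Hypothesis p_prime : prime p.
Hypothesis R_char0 : forall n, (0 < n)%N -> n%:R != 0 :> R.
Variable psip : fps R -> fps R.
Hypothesis psip0 : forall u : fps R, u 0%N = 1 -> psip u 0%N = 0.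
Hypothesis d_psip : forall u : fps R, u 0%N = 1 ->
  fps_deltaq (psip u) = fps_phip p phi (psi_q u) - psi_q u.
Implicit Types (u v w g h : fps R) (n m k N : nat) (nu : {poly {poly R}}).
Let p_gt0 : (0 < p)%N := prime_gt0 p_prime.

Local Notation phip := (fps_phip p phi).
Local Notation deltaq := (@fps_deltaq R).

Lemma fps_deltaq_inj u v : u 0%N = v 0%N -> deltaq u = deltaq v -> u = v.
Proof.
move=> uv0 duv; apply: fpsP => -[//|n]; apply: (mulfI (R_char0 (ltn0Sn n))).
exact: (congr1 (fun w : fps R => w n.+1) duv).
Qed.

Lemma fps_coefM01 u v : u 0%N = 1 -> v 0%N = 1 -> (u * v) 0%N = 1.
Proof. by move=> u0 v0; rewrite fps_coefM0 u0 v0 mulr1. Qed.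

Lemma psi_qM u v : u \is a GRing.unit -> v \is a GRing.unit ->
  psi_q (u * v) = psi_q u + psi_q v.
Proof.
move=> uU vU; apply: (@mulIr _ (u * v)); first by rewrite unitrM uU.
have [hu hv] := (divrK uU (deltaq u), divrK vU (deltaq v)).
rewrite {1}/psi_q divrK ?unitrM ?uU // fps_deltaqM -{1}hu -{1}hv /psi_q.
by ring.
Qed.

(** A series is determined by its constant term and its derivative, and the derivative of [psip u]
    depends additively on [psi_q u]. *)
Lemma psipM u v : u 0%N = 1 -> v 0%N = 1 -> psip (u * v) = psip u + psip v.
Proof.
move=> u0 v0; apply: fps_deltaq_inj.
  by rewrite fps_coefD !psip0 ?fps_coefM01 // addr0.
rewrite fps_deltaqD !d_psip ?fps_coefM01 // psi_qM ?fps_inv_exists //.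
by rewrite fps_phipD; ring.
Qed.

Lemma fps_phip_iter_coef i u n :
  iter i phip u n = if (p ^ i %| n)%N then iter i phi (u (n %/ p ^ i)%N) else 0.
Proof.
elim: i n => [|i IHi] n; first by rewrite dvd1n divn1.
rewrite iterS /= IHi expnS.
have [pn|pn] := boolP (p %| n)%N; last first.
  by case: ifP => // /(dvdn_trans (dvdn_mulr _ (dvdnn p))); rewrite (negPf pn).
by rewrite divnMA dvdn_divRL // mulnC; case: ifP; rewrite ?rmorph0.
Qed.

Lemma fps_deltaq_iter_coef j u n : iter j deltaq u n = n%:R ^+ j * u n.
Proof.
by elim: j => [|j IHj]; rewrite ?mul1r // iterS /= IHj exprS mulrA.
Qed.

Lemma op_nuD nu u v : op_nu p phi nu (u + v) = op_nu p phi nu u + op_nu p phi nu v.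
Proof.
have iterD (f : fps R -> fps R) k : {morph f : x y / x + y} ->
    {morph iter k f : x y / x + y}.
  by move=> fD x y; elim: k => //= k ->; rewrite fD.
rewrite /op_nu -big_split /=; apply: eq_bigr => i _; rewrite -big_split /=.
apply: eq_bigr => j _; rewrite -mulrDr.
by rewrite (iterD deltaq _ (@fps_deltaqD R)) (iterD phip _ (@fps_phipD p R phi)).
Qed.

(** Regarding [lam] as a polynomial in two variables, constant in xi_q, lets the lemmas on [op_nu]
    serve both operators. *)
Lemma op_lambdaE lam u : op_lambda p phi lam u = op_nu p phi lam^:P u.
Proof.
rewrite /op_lambda /op_nu size_map_polyC; apply: eq_bigr => i _.
rewrite coef_map size_polyC; case: eqP => [->|_].
  by rewrite big_ord0; apply: fpsP => n; rewrite fps_coefCM mul0r fps_coef0.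
by rewrite big_ord_recl big_ord0 addr0 coefC.
Qed.

(** The coefficient of q^n after phi_p^i only involves the index n / p^i, so the hypothesis kills
    all terms with i > 0; in the remaining ones delta_q acts as multiplication by n. *)
Lemma op_nu_coef_leading nu u n :
  (forall i, (0 < i)%N -> (p ^ i %| n)%N -> u (n %/ p ^ i)%N = 0) ->
  op_nu p phi nu u n = (nu`_0).[n%:R] * u n.
Proof.
move=> un0; rewrite fps_coef_sum.
have term0 i (x : {poly R}) : (0 < i)%N ->
    (\sum_(j < size x) fpsC x`_j * iter i phip (iter j deltaq u)) n = 0.
  move=> i0; rewrite fps_coef_sum big1 // => j _.
  rewrite fps_coefCM fps_phip_iter_coef; case: ifP => [pn|_]; last by rewrite mulr0.
  rewrite fps_deltaq_iter_coef un0 // mulr0 -[iter _ _ _]/(iter i phi 0).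
  by rewrite (_ : iter i phi 0 = 0) ?mulr0 //; elim: (i) => //= k ->; rewrite rmorph0.
have -> : (nu`_0).[n%:R] * u n =
    (\sum_(j < size nu`_0) fpsC nu`_0`_j * iter j deltaq u) n.
  rewrite horner_coef mulr_suml fps_coef_sum; apply: eq_bigr => j _.
  by rewrite fps_coefCM fps_deltaq_iter_coef mulrA.
case: (size nu) (@nth_default _ 0 nu 0%N) => [|s] nu0.
  by rewrite nu0 // !big_ord0 size_poly0 big_ord0 fps_coef0.
by rewrite big_ord_recl [X in _ + X]big1 ?addr0 // => i _; apply: term0.
Qed.

Lemma op_nu_coef_first nu u n : (0 < n)%N -> (forall i, (i < n)%N -> u i = 0) ->
  op_nu p phi nu u n = (nu`_0).[n%:R] * u n.
Proof.
move=> n0 un; apply: op_nu_coef_leading => i i0 _; apply: un.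
by rewrite ltn_Pdiv // -(exp1n i) ltn_exp2r // prime_gt1.
Qed.

Lemma psi_q_leading u m : u 0%N = 1 -> (forall i, (0 < i < m)%N -> u i = 0) ->
  forall i, (i <= m)%N -> psi_q u i = i%:R * u i.
Proof.
move=> u0 um i im; have duE := divrK (fps_inv_exists u0) (deltaq u).
rewrite -/(psi_q u) in duE; have coefE j := congr1 (fun w : fps R => w j) duE.
have h0 : psi_q u 0%N = 0.
  by have := coefE 0%N; rewrite fps_coefM0 u0 mulr1 /= mul0r.
case: i im => [|i] im; first by rewrite h0 mul0r.
have := coefE i.+1; rewrite fps_coefM_ends // ?h0 ?u0 ?mul0r ?add0r ?mulr1 //.
by move=> j ji; rewrite um ?mulr0 //; lia.
Qed.

(** In the identity for the derivative, divided by i, the phi_p part reads [psi_q u] at i / p, a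
    positive index below m, where it vanishes. *)
Lemma psip_leading u m : u 0%N = 1 -> (forall i, (0 < i < m)%N -> u i = 0) ->
  forall i, (0 < i <= m)%N -> psip u i = - u i.
Proof.
move=> u0 um i /andP[i0 im]; apply: (mulfI (R_char0 i0)).
have := psi_q_leading u0 um; have := d_psip u0; move: (psi_q u) => h dE hE.
have := congr1 (fun w : fps R => w i) dE; rewrite fps_coefB /= => ->.
rewrite (hE i) // mulrN; case: ifP => [pi|_]; last by rewrite sub0r.
have ip : (i %/ p < i)%N by rewrite ltn_Pdiv // prime_gt1.
have ip0 : (0 < i %/ p)%N by rewrite divn_gt0 // dvdn_leq.
rewrite hE ?(leq_trans (ltnW ip)) // um ?ip0 ?(leq_trans ip) //.
by rewrite mulr0 rmorph0 sub0r.
Qed.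

Lemma fps_quotient_leading u v m : u 0%N = 1 -> v 0%N = 1 ->
  (forall i, (i < m)%N -> u i = v i) ->
  forall i, (0 < i <= m)%N -> (u / v) i = u i - v i.
Proof.
move=> u0 v0 uv; elim/ltn_ind => i IHi /andP[i0 im].
have w0 : (u / v) 0%N = 1 by rewrite fps_coefM01 // fps_coefV0.
move: (u / v) w0 IHi (divrK (fps_inv_exists v0) u) => w w0 IHi wvE.
have := congr1 (fun x : fps R => x i) wvE.
rewrite fps_coefM_ends // ?w0 ?v0; first by rewrite mul1r mulr1 => <-; ring.
by move=> j /andP[j0 ji]; rewrite IHi ?j0 ?uv ?subrr ?mul0r //; lia.
Qed.

(** Multiplying a series by 1 + c q^n + ... leaves its image under [psip] unchanged below n and
    subtracts c at n, so the coefficients can be chosen one after the other. *)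
Lemma psip_surj g : g 0%N = 0 -> exists2 u : fps R, u 0%N = 1 & psip u = g.
Proof.
move=> g0; pose step n (b : nat -> R) : R := if n == 0%N then 1 else psip (Fps b) n - g n.
have [a aE] := course_of_values_rec step 0; pose u := Fps a.
have u0 : u 0%N = 1 by rewrite /= aE.
exists u => //; apply: fpsP => -[|n]; first by rewrite psip0.
pose v : fps R := Fps (fun i => if (i < n.+1)%N then a i else 0).
have v0 : v 0%N = 1 by [].
have w0 : (u / v) 0%N = 1 by rewrite fps_coefM01 // fps_coefV0.
have uv i : (i < n.+1)%N -> u i = v i by rewrite /= => ->.
have wE := fps_quotient_leading u0 v0 uv.
have <- := divrK (fps_inv_exists v0) u.
have wz i : (0 < i < n.+1)%N -> (u / v) i = 0.
  by move=> /andP[i0 ilt]; rewrite wE ?uv ?subrr // i0 ltnW.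
rewrite psipM // fps_coefD (psip_leading w0 wz) ?leqnn // wE ?leqnn //.
by rewrite [u n.+1]aE /step /= -/v ltnn; ring.
Qed.

(** A coefficient of positive index of [phip u] is 0 or the image of one of smaller index, so
    vanishing propagates upwards. *)
Lemma fps_phip_fixed u : u 0%N = 0 -> phip u = u -> u = 0.
Proof.
move=> u0 uE; apply: fpsP; elim/ltn_ind => -[|n] IHn; first by rewrite u0.
have npn : (n.+1 %/ p < n.+1)%N by rewrite ltn_Pdiv // prime_gt1.
by rewrite -uE /=; case: ifP => // _; rewrite (IHn _ npn) fps_coef0 rmorph0.
Qed.

(** * The kernel of the character and its coordinate of index kappa *)

Variables (nu : {poly {poly R}}) (lam : {poly R}).

(* The value mu(0, n) of the characteristic polynomial. *)
Definition char_value n : R := (nu`_0).[n%:R] * n%:R - lam`_0.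

Definition log_character u : fps R :=
  op_nu p phi nu (psi_q u) + op_nu p phi lam^:P (psip u).

Definition log_kernel u : Prop := u 0%N = 1 /\ log_character u = 0.

Lemma log_characterM u v : u 0%N = 1 -> v 0%N = 1 ->
  log_character (u * v) = log_character u + log_character v.
Proof.
move=> u0 v0; rewrite !/log_character psipM // psi_qM ?fps_inv_exists //.
by rewrite !op_nuD; ring.
Qed.

(** At index n, [psi_q u] is n u_n and [psip u] is -u_n, and only the part of degree 0 in xi_p acts
    on the leading term. *)
Lemma log_character_leading u n : (0 < n)%N -> u 0%N = 1 ->
  (forall i, (0 < i < n)%N -> u i = 0) -> log_character u n = char_value n * u n.
Proof.
move=> n0 u0 un; rewrite /log_character fps_coefD !op_nu_coef_first //.
- rewrite (@psi_q_leading _ n) // (@psip_leading _ n) // ?n0 ?leqnn //.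
  by rewrite coef_map hornerC /char_value; ring.
- move=> [|i] ilt; first by rewrite psip0.
  by rewrite (psip_leading u0 un) ?(ltnW ilt) // un ?oppr0.
- by move=> [|i] ilt; rewrite (psi_q_leading u0 un (ltnW ilt)) ?mul0r // un ?mulr0.
Qed.

Lemma log_kernelM u v : log_kernel u -> log_kernel v -> log_kernel (u * v).
Proof.
by move=> [u0 pu] [v0 pv]; split; rewrite ?fps_coefM01 // log_characterM // pu pv addr0.
Qed.

Lemma log_kernel_1 : log_kernel 1.
Proof.
split=> //; apply: (@addrI _ (log_character 1)).
by rewrite -log_characterM ?mulr1 ?addr0.
Qed.

Lemma log_kernelV u : log_kernel u -> log_kernel u^-1.
Proof.
move=> [u0 pu]; have v0 := fps_coefV0 u0; split=> //.
have := log_characterM u0 v0; rewrite mulrV ?fps_inv_exists // pu add0r => <-.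
by case: log_kernel_1.
Qed.

Lemma log_kernel_div u v : log_kernel u -> log_kernel v -> log_kernel (u / v).
Proof. by move=> Uu Uv; apply/log_kernelM/log_kernelV. Qed.

Variable kappa : nat.
Hypotheses (kappa_gt0 : (0 < kappa)%N) (char_kappa : char_value kappa = 0).
Hypothesis char_neq0 : forall n, (0 < n)%N -> n <> kappa -> char_value n != 0.
Hypothesis char_unit :
  forall n, (0 < n)%N -> (p %| n)%N -> char_value n \is a GRing.unit.

Let kappa_coprime : ~~ (p %| kappa)%N.
Proof.
by apply/negP => /(char_unit kappa_gt0); rewrite char_kappa unitr0.
Qed.

(** A first nonzero coefficient u_i would be killed by mu(0, i), which is nonzero for i below
    kappa. *)
Lemma log_kernel_coef_lt_kappa u : log_kernel u -> forall i, (0 < i < kappa)%N -> u i = 0.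
Proof.
move=> [u0 pu]; elim/ltn_ind => i IHi /andP[i0 ik].
have uz j : (0 < j < i)%N -> u j = 0.
  by move=> /andP[j0 ji]; apply: IHi; rewrite // j0 (ltn_trans ji).
have i_neq : i <> kappa by move=> iE; rewrite iE ltnn in ik.
have /esym/eqP := log_character_leading i0 u0 uz.
by rewrite pu fps_coef0 mulf_eq0 (negPf (char_neq0 i0 i_neq)) => /eqP.
Qed.

Lemma log_kernel_coef_kappaM u v : log_kernel u -> log_kernel v ->
  (u * v) kappa = u kappa + v kappa.
Proof.
move=> Uu Uv; rewrite fps_coefM_ends //.
  by case: Uu Uv => [-> _] [-> _]; rewrite mul1r mulr1 addrC.
by move=> i ik; rewrite log_kernel_coef_lt_kappa ?mul0r.
Qed.

(** If n is the first index where u and v differ, the kernel element u / v is 1 + (u_n - v_n) q^n +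
    ..., while mu(0, n) is nonzero. *)
Lemma log_kernel_inj u v : log_kernel u -> log_kernel v -> u kappa = v kappa -> u = v.
Proof.
move=> Uu Uv uvk; apply: fpsP; elim/ltn_ind => -[|n] IHn.
  by case: Uu Uv => [-> _] [-> _].
have [-> //|/eqP nk] := eqVneq n.+1 kappa.
have [[u0 _] [v0 _]] := (Uu, Uv); have wE := fps_quotient_leading u0 v0 IHn.
have wz i : (0 < i < n.+1)%N -> (u / v) i = 0.
  by move=> /andP[i0 ilt]; rewrite wE ?IHn ?subrr // i0 ltnW.
have [w0 pw] := log_kernel_div Uu Uv.
have /esym/eqP := log_character_leading (ltn0Sn n) w0 wz.
rewrite pw fps_coef0 wE ?leqnn // mulf_eq0 (negPf (char_neq0 _ _)) //.
by rewrite subr_eq0 => /eqP.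
Qed.

(** Here [g] and [h] stand for [psip u] and [psi_q u]. Eliminating h_n by means of the third
    equation leaves mu(0, n) g_n equal to an expression in earlier coefficients. If p divides n, the
    pivot is a unit; otherwise that expression vanishes, so g_n = 0 will do, and at n = kappa any
    value will. *)
Lemma char_system_solution (alpha : R) : exists g h : fps R,
  [/\ g 0%N = 0, h 0%N = 0, deltaq g = phip h - h, g kappa = alpha
    & op_nu p phi nu h + op_nu p phi lam^:P g = 0].
Proof.
pose F x y : fps R := op_nu p phi nu y + op_nu p phi lam^:P x.
pose fstp (b : nat -> R * R) : fps R := Fps (fun i => (b i).1).
pose sndp (b : nat -> R * R) : fps R := Fps (fun i => (b i).2).
pose gstep n b : R := if (p %| n)%N then
  (F (fstp b) (sndp b) n + (nu`_0).[n%:R] * phip (sndp b) n) / char_value n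
  else if n == kappa then alpha else 0.
pose step n b : R * R := if n == 0%N then (0, 0) else
  (gstep n b, phip (sndp b) n - n%:R * gstep n b).
have [a aE] := course_of_values_rec step (0, 0).
pose g := fstp a; pose h := sndp a.
have g0 : g 0%N = 0 by rewrite /= aE.
have h0 : h 0%N = 0 by rewrite /= aE.
pose b n i := if (i < n)%N then a i else (0, 0).
have gE n : (0 < n)%N -> g n = gstep n (b n).
  by move=> n0; rewrite /= aE /step gtn_eqF.
have phipE n : (0 < n)%N -> phip (sndp (b n)) n = phip h n.
  by move=> n0; rewrite /= /b ltn_Pdiv // prime_gt1.
have hE n : (0 < n)%N -> h n = phip h n - n%:R * g n.
  by move=> n0; rewrite gE // -phipE // /= aE /step gtn_eqF.
exists g, h; split=> //.
- apply: fpsP => -[|n]; first by rewrite fps_coefB /= mul0r dvdn0 div0n aE rmorph0 subrr.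
  by rewrite fps_coefB [h n.+1]hE //= opprB addrC subrK.
- by rewrite gE // /gstep (negPf kappa_coprime) eqxx.
- apply: fpsP => n; rewrite fps_coef0; case: (posnP n) => [->|n0].
    rewrite fps_coefD !op_nu_coef_leading ?g0 ?h0 ?mulr0 ?addr0 // => i _ _;
      by rewrite div0n.
  have split_at (x y : fps R) (nu' : {poly {poly R}}) :
      (forall i, (i < n)%N -> x i = y i) -> y n = 0 ->
      op_nu p phi nu' x n = op_nu p phi nu' y n + (nu'`_0).[n%:R] * x n.
    move=> xy yn; rewrite -[x in LHS](subrK y) op_nuD fps_coefD addrC.
    rewrite [op_nu _ _ _ (x - y) n]op_nu_coef_first ?fps_coefB ?yn ?subr0 //.
    by move=> i ilt; rewrite fps_coefB xy ?subrr.
  have hb i : (i < n)%N -> h i = sndp (b n) i by rewrite /= /b => ->.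
  have gb i : (i < n)%N -> g i = fstp (b n) i by rewrite /= /b => ->.
  have [hbn gbn] : sndp (b n) n = 0 /\ fstp (b n) n = 0 by rewrite /= /b ltnn.
  rewrite fps_coefD (split_at _ _ _ hb hbn) (split_at _ _ _ gb gbn).
  rewrite coef_map hornerC hE //.
  have -> : forall A B C D E G : R, A + B * (C - D * E) + (G + lam`_0 * E) =
    A + G + B * C - (B * D - lam`_0) * E by move=> *; ring.
  rewrite -/(char_value n) -fps_coefD -/(F _ _) gE // /gstep -phipE //.
  have [pn|pn] := boolP (p %| n)%N.
    by rewrite [char_value n * _]mulrC divrK ?char_unit // subrr.
  (* Away from the multiples of p, no positive power of phi_p contributes. *)
  have phip0 x : phip x n = 0 by rewrite /= (negPf pn).
  rewrite phip0 mulr0 addr0 fps_coefD !op_nu_coef_leading ?hbn ?gbn.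
  + rewrite !mulr0 addr0 sub0r.
    by case: eqP => [->|_]; rewrite ?char_kappa ?mul0r ?mulr0 oppr0.
  + by move=> i i0 /(dvdn_trans (dvdn_exp i0 (dvdnn p))); rewrite (negPf pn).
  + by move=> i i0 /(dvdn_trans (dvdn_exp i0 (dvdnn p))); rewrite (negPf pn).
Qed.

Lemma log_kernel_surj (alpha : R) : exists2 u, log_kernel u & u kappa = alpha.
Proof.
(* The sign compensates that of [psip], whose coefficient at kappa is -u_kappa on the kernel. *)
have [g [h [g0 h0 dg gk Fgh]]] := char_system_solution (- alpha).
have [u u0 pu] := psip_surj g0.
(* phi_p - 1 takes the same value on [psi_q u] and on [h], and it is injective on series without
   constant term. *)
have qu : psi_q u = h.
  apply/eqP; rewrite -subr_eq0; apply/eqP/fps_phip_fixed.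
    rewrite fps_coefB h0 (@psi_q_leading u 0) // ?mul0r ?subr0 // => i.
    by rewrite ltn0 andbF.
  have := d_psip u0; rewrite pu dg fps_phipB => E.
  apply/eqP; rewrite -subr_eq0; apply/eqP.
  transitivity (phip (psi_q u) - psi_q u - (phip h - h)); first by ring.
  by rewrite E; ring.
have Uu : log_kernel u by split=> //; rewrite /log_character qu pu.
exists u => //; apply: oppr_inj; rewrite -gk -pu.
by rewrite (psip_leading u0 (log_kernel_coef_lt_kappa Uu)) // kappa_gt0 /=.
Qed.

End CharacterKernel.

(** * Evaluation at q0 *)

Section Evaluation.
Variables (p : nat) (R : idomainType).
Hypotheses (R_sep : padic_separated p R) (R_compl : padic_complete p R).
Implicit Types (u v : fps R) (n N : nat).

Lemma eqmodp_term n (c q0 : R) N : q0 = p%:R ^+ n * c ->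
  forall x, eqmodp p (n * N) (x * q0 ^+ N) 0.
Proof.
by move=> -> x; exists (x * c ^+ N); rewrite subr0 exprMn -exprM; ring.
Qed.

Lemma fps_eval_cvg u n (c q0 : R) : (0 < n)%N -> q0 = p%:R ^+ n * c ->
  padic_cvg p (fun N => \sum_(i < N) u i * q0 ^+ i) (fps_eval p u q0).
Proof.
move=> n0 qE; apply/padic_lim_cvg/R_compl/padic_cauchyS => k; exists k => N kN.
rewrite big_ord_recr -eqmodp_subr0 addrC addKr.
by apply: eqmodp_leq (eqmodp_term N qE (u N)); nia.
Qed.

Lemma fps_eval_eqmodp u n (c q0 : R) N : (0 < n)%N -> q0 = p%:R ^+ n * c ->
  eqmodp p (n * N) (fps_eval p u q0) (\sum_(i < N) u i * q0 ^+ i).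
Proof.
move=> n0 qE; have [M cvM] := fps_eval_cvg u n0 qE (n * N).
apply: eqmodp_trans (eqmodp_sym (cvM (maxn M N) (leq_maxl _ _))) _.
apply: (@eqmodp_telescope _ _ (fun N => \sum_(i < N) u i * q0 ^+ i) _ N).
  move=> m Nm; rewrite big_ord_recr -eqmodp_subr0 addrC addKr.
  by apply: eqmodp_leq (eqmodp_term m qE (u m)); rewrite leq_mul2l Nm orbT.
exact: leq_maxr.
Qed.

Lemma fps_eval_const u (q0 : R) : (forall i, (0 < i)%N -> u i * q0 ^+ i = 0) ->
  fps_eval p u q0 = u 0%N.
Proof.
move=> u0; apply: padic_limE => // n; exists 1%N => -[//|m] _.
rewrite big_ord_recl expr0 mulr1 big1 ?addr0; first exact: eqmodp_refl.
by move=> i _; apply: u0.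
Qed.

Lemma fps_eval_at0 u : fps_eval p u 0 = u 0%N.
Proof. by apply: fps_eval_const => i i0; rewrite expr0n gtn_eqF ?mulr0. Qed.

Lemma fps_evalC (c q0 : R) : fps_eval p (fpsC c) q0 = c.
Proof. by rewrite fps_eval_const // => -[//|i] _; rewrite mul0r. Qed.

Lemma fps_evalM u v n (c q0 : R) : (0 < n)%N -> q0 = p%:R ^+ n * c ->
  fps_eval p (u * v) q0 = fps_eval p u q0 * fps_eval p v q0.
Proof.
move=> n0 qE; apply/eqP; rewrite -subr_eq0; apply/eqP/R_sep => N.
rewrite eqmodp_subr0; have NnN : (N <= n * N)%N by nia.
have evE w := eqmodp_leq NnN (fps_eval_eqmodp w N n0 qE).
apply: eqmodp_trans (evE _) _; apply: eqmodp_sym.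
apply: eqmodp_trans (eqmodpM (evE u) (evE v)) _.
have horE (w : fps R) : \sum_(i < N) w i * q0 ^+ i = (fps_trunc N w).[q0].
  by rewrite horner_poly.
(* The product of the truncations has at most 2N coefficients: the first N are those of [u * v], and
   the others meet powers of [q0] divisible by p^N. *)
rewrite (horE u) (horE v) -hornerM (@horner_coef_wide _ (N + N)); last first.
  apply: leq_trans (size_polyMleq _ _) _; apply: leq_trans (leq_pred _) _.
  by rewrite leq_add // size_poly.
rewrite big_split_ord /= -[X in eqmodp _ _ _ X]addr0; apply: eqmodpD.
  apply: eqmodp_sum => i _; rewrite -(@fps_coefM_poly _ N i u v) //;
    try by move=> j; apply: coef_fps_trunc.
  exact: eqmodp_refl.
have zE := @big1 R 0 +%R 'I_N (index_enum 'I_N) xpredT (fun=> 0)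
  (fun _ _ => erefl).
rewrite -[X in eqmodp _ _ _ X]zE.
apply: eqmodp_sum => i _; apply: eqmodp_leq (eqmodp_term _ qE _).
by nia.
Qed.

(** The tail beyond index m lies in p^(n (m+1)), and n (m+1) > m n. *)
Lemma fps_eval_leading u m n (c q0 : R) : (0 < m)%N -> (0 < n)%N -> q0 = p%:R ^+ n * c ->
  u 0%N = 1 -> (forall i, (0 < i < m)%N -> u i = 0) ->
  eqmodp p (m * n).+1 (fps_eval p u q0) (1 + p%:R ^+ (m * n) * (c ^+ m * u m)).
Proof.
move=> m0 n0 qE u0 um.
apply: (@eqmodp_leq _ _ (n * m.+1)); first by nia.
apply: eqmodp_trans (fps_eval_eqmodp u m.+1 n0 qE) _.
rewrite big_ord_recr /= -(prednK m0) big_ord_recl /= (prednK m0) big1.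
  rewrite u0 addr0 expr0 mulr1 qE exprMn -exprM (mulnC n m) [u m * _]mulrC -mulrA.
  exact: eqmodp_refl.
by move=> i _; rewrite um ?mul0r //= /bump; have := ltn_ord i; lia.
Qed.

End Evaluation.

(* A group [U], identified with [R] by [coord], maps bijectively onto
   1 + p^m R as soon as the leading term of [ev] is linear in [coord]. *)
Section FilteredBijection.
Variables (p : nat) (R : idomainType).
Hypotheses (p_prime : prime p) (p_neq2 : p <> 2%N).
Hypotheses (R_sep : padic_separated p R) (R_compl : padic_complete p R).
Hypothesis p_neq0 : p%:R != 0 :> R.
Variables (S : comUnitRingType) (U : S -> Prop) (coord ev : S -> R).
Hypotheses (U_unit : forall u, U u -> u \is a GRing.unit) (U_1 : U 1).
Hypotheses (U_M : forall u v, U u -> U v -> U (u * v)) (U_V : forall u, U u -> U u^-1).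
Hypothesis coordM : forall u v, U u -> U v -> coord (u * v) = coord u + coord v.
Hypothesis coord_inj : forall u v, U u -> U v -> coord u = coord v -> u = v.
Hypothesis coord_surj : forall x, exists2 u, U u & coord u = x.
Hypotheses (ev1 : ev 1 = 1) (evM : {morph ev : u v / u * v}).
Variables (m : nat) (d : R).
Hypotheses (m_gt0 : (0 < m)%N) (d_unit : d \is a GRing.unit).
Hypothesis ev_leading : forall u, U u ->
  eqmodp p m.+1 (ev u) (1 + p%:R ^+ m * (d * coord u)).
Implicit Types (u v w : S) (k : nat).
Let p_gt0 : (0 < p)%N := prime_gt0 p_prime.

Let U_X u k : U u -> U (u ^+ k).
Proof. by move=> Uu; elim: k => [//|k IHk]; rewrite exprS; apply: U_M. Qed.

Let coordX u k : U u -> coord (u ^+ k) = k%:R * coord u.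
Proof.
move=> Uu; elim: k => [|k IHk].
  by apply: (addrI (coord 1)); rewrite -coordM // mulr1 mul0r addr0.
by rewrite exprS (coordM Uu (U_X k Uu)) IHk -natr1; ring.
Qed.

Let evX u k : ev (u ^+ k) = ev u ^+ k.
Proof. by elim: k => // k IHk; rewrite !exprS evM IHk. Qed.

(** An element whose coordinate is divisible by p is a p-th power in U. For odd p, raising to the
    power p moves the leading term of the value exactly one step further. *)
Lemma filtered_scaled k u b : U u -> coord u = p%:R ^+ k * b ->
  eqmodp p (m + k).+1 (ev u) (1 + p%:R ^+ (m + k) * (d * b)).
Proof.
elim: k u => [|k IHk] u Uu ukE.
  by rewrite addn0; have := ev_leading Uu; rewrite ukE mul1r.
have [v Uv vE] := coord_surj (p%:R ^+ k * b).
have -> : u = v ^+ p.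
  by apply: coord_inj => //; [apply: U_X | rewrite coordX // vE ukE exprS mulrA].
rewrite evX; have [z /eqP] := IHk v Uv vE.
rewrite subr_eq addrC -addrA => /eqP ->.
rewrite exprS (mulrC p%:R) -(mulrA _ p%:R) -mulrDr addnS.
have mk_gt0 : (0 < m + k)%N by rewrite addn_gt0 m_gt0.
apply: eqmodp_trans (eqmodp_expp1D _ p_prime p_neq2 mk_gt0) _.
rewrite mulrDr addrA; exists z.
by rewrite !exprS; ring.
Qed.

Lemma filtered_eq1 k u : U u -> eqmodp p k (coord u) 0 -> eqmodp p (m + k) (ev u) 1.
Proof.
move=> Uu [b]; rewrite subr0 => ukE.
apply: (eqmodp_trans (eqmodp_leq (leqnSn _) (filtered_scaled Uu ukE))).
by rewrite -[X in eqmodp _ _ _ X]addr0; apply: eqmodpD;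
  [apply: eqmodp_refl | apply: eqmodp_mulX].
Qed.

(** The coordinate of u / v is divisible by every power of p: if it is p^k b, the value 1 of
    [ev (u / v)] forces d b, hence b, to be divisible by p. *)
Lemma filtered_inj u v : U u -> U v -> ev u = ev v -> u = v.
Proof.
move=> Uu Uv uv; have vU := U_unit Uv.
have Uw : U (u / v) by apply/U_M/U_V.
have evw : ev (u / v) = 1.
  by rewrite evM uv -evM mulrV.
have wk k : eqmodp p k (coord (u / v)) 0.
  elim: k => [|k [b]]; first by exists (coord (u / v)); rewrite subr0 mul1r.
  rewrite subr0 => wE; have := filtered_scaled Uw wE.
  rewrite evw => -[z]; rewrite opprD addNKr => zE.
  have pU : p%:R ^+ (m + k) != 0 :> R by rewrite expf_neq0.
  have bE : b = - (p%:R * (d^-1 * z)).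
    apply: (mulrI d_unit); apply: (mulfI pU); apply: oppr_inj; rewrite zE exprS.
    rewrite -[z in LHS](mulKr d_unit); ring.
  by exists (- (d^-1 * z)); rewrite subr0 wE bE exprS; ring.
have coord_w : coord (u / v) = 0 by apply: R_sep.
have coord1 : coord 1 = 0 by rewrite -(expr0 u) coordX // mul0r.
have uvE : u / v = 1 by apply: coord_inj => //; rewrite coord1.
by rewrite -[u](divrK vU) uvE mul1r.
Qed.

(** Successive approximation, each step removing the leading error. As [S] carries no topology, the
    limit is taken among the coordinates and then lifted to U. *)
Lemma filtered_surj g : eqmodp p m g 1 -> exists2 u, U u & ev u = g.
Proof.
move=> g1; pose good k u := U u /\ eqmodp p (m + k) (ev u) g.
have good0 : good 0%N 1.
  by split; [exact: U_1 | rewrite ev1 addn0; apply: eqmodp_sym].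
(* The step is made total, with an arbitrary result on pairs that are not good, so that a single
   choice function can be iterated. *)
have /choice[F Fgood] : forall x : nat * S, exists u', good x.1 x.2 ->
    good x.1.+1 u' /\ eqmodp p x.1 (coord u') (coord x.2).
  move=> [k u] /=; have [[Uu [y yE]]|] := pselect (good k u); last first.
    by move=> ngood; exists u.
  (* With this coordinate [ev w] starts with 1 - p^(m+k) y, which cancels the error p^(m+k) y
     because [ev u] is congruent to 1 modulo p. *)
  have [w Uw wE] := coord_surj (p%:R ^+ k * (d^-1 * - y)).
  exists (u * w) => _; split; first split; first exact: U_M.
    rewrite evM addnS.
    have := filtered_scaled Uw wE; rewrite mulVKr //.
    move/(eqmodpMl (ev u))/eqmodp_trans; apply.
    rewrite mulrDr mulr1 mulrCA.
    have [z zE] : eqmodp p 1 (ev u) 1.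
      apply: (@eqmodp_leq _ _ m) => //; apply: eqmodp_trans g1.
      by apply: (@eqmodp_leq _ _ (m + k)); [apply: leq_addr | exists y].
    exists (- (z * y)).
    have -> : g = ev u - p%:R ^+ (m + k) * y by rewrite -yE; ring.
    have -> : ev u = 1 + p%:R * z by rewrite -[LHS](subrK 1) zE expr1 addrC.
    by rewrite exprS; ring.
  by rewrite coordM // -eqmodp_subr0 addrC addKr wE; apply: eqmodp_mulX.
pose s := fix s k := if k is k'.+1 then F (k', s k') else 1.
have sgood k : good k (s k).
  by elim: k => // k IHk; have [] := Fgood (k, s k) IHk.
have sS k : eqmodp p k (coord (s k.+1)) (coord (s k)).
  by have [] := Fgood (k, s k) (sgood k).
have [alpha alphaE] : exists l, padic_cvg p (fun k => coord (s k)) l.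
  apply/R_compl/padic_cauchyS => k; exists k => N kN.
  exact: eqmodp_leq kN (sS N).
have sE k : eqmodp p k alpha (coord (s k)).
  have [N cvN] := alphaE k.
  apply: eqmodp_trans (eqmodp_sym (cvN (maxn N k) (leq_maxl _ _))) _.
  apply: (@eqmodp_telescope _ _ (fun k => coord (s k)) _ k) => [j kj|].
    exact: eqmodp_leq kj (sS j).
  exact: leq_maxr.
have [u Uu uE] := coord_surj alpha; exists u => //.
apply/eqP; rewrite -subr_eq0; apply/eqP/R_sep => k; rewrite eqmodp_subr0.
have [Us evs] := sgood k.
apply: (@eqmodp_leq _ _ (m + k)); first exact: leq_addl.
apply: eqmodp_trans evs.
have sU := U_unit Us.
(* The coordinate of u / s_k is divisible by p^k, so its value is congruent to 1 modulo p^(m+k). *)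
rewrite -[u in ev u](divrK sU) evM -[X in eqmodp _ _ _ X]mul1r.
apply: eqmodpM; last exact: eqmodp_refl.
apply: filtered_eq1; first exact/U_M/U_V.
have : coord (u / s k * s k) = alpha by rewrite divrK.
rewrite coordM //; last exact/U_M/U_V.
move=> wE; rewrite -[coord (u / s k)](addrK (coord (s k))) wE eqmodp_subr0.
exact: sE.
Qed.

End FilteredBijection.

(** * Units and roots of unity of R *)

Section UnramifiedRing.
Variables (p : nat) (R : idomainType).
Hypotheses (p_prime : prime p) (R_ur : is_completed_max_unramified p R).
Let p_gt0 : (0 < p)%N := prime_gt0 p_prime.

Lemma ur_separated : padic_separated p R.
Proof. by have [? [? [? [? [_ _ []]]]]] := R_ur. Qed.

Lemma ur_complete : padic_complete p R.
Proof. by have [? [? [? [? [_ _ []]]]]] := R_ur. Qed.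

(** If n vanished in A it would vanish in Zp, and p^n would divide n in the integers, against p^n >
    n. *)
Lemma unramified_ext_char0 (Zp A : idomainType) (f : {rmorphism Zp -> A}) n :
  is_padic_completion p (intr : int -> Zp) -> is_unramified_ext p f ->
  (0 < n)%N -> n%:R != 0 :> A.
Proof.
move=> [_ _ refl_int _] [f_inj _ _ _] n0; apply/eqP => nA0.
have nZ0 : n%:R = 0 :> Zp by apply: f_inj; rewrite rmorph_nat rmorph0.
have [|z] := refl_int n n%:Z; first by rewrite -pmulrn nZ0; apply: eqmodp_refl.
rewrite subr0 -natrX natz => /(congr1 absz); rewrite abszM !absz_nat.
move=> nE; have : (p ^ n <= n)%N by rewrite dvdn_leq // {2}nE dvdn_mulr.
by rewrite leqNgt ltn_expl // prime_gt1.
Qed.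

Lemma unramified_ext_coprime_unit (Zp A : idomainType) (f : {rmorphism Zp -> A}) t :
  is_unramified_ext p f -> coprime p t -> t%:R \is a @GRing.unit A.
Proof.
move=> [_ _ pN loc] cpt; apply: loc => -[z]; rewrite subr0 expr1 => tE.
have [t0|t0] := posnP t.
  by move: cpt p_prime; rewrite t0 /coprime gcdn0 => /eqP ->.
case: (@egcdnP t p t0) => a b; rewrite gcdnC (eqP cpt) => abE _.
case/negP: pN; apply/unitrPr; exists (a%:R * z - b%:R).
rewrite mulrBr mulrCA -tE -!natrM abE natrD mulnC; ring.
Qed.

Lemma ur_coprime_unit t : coprime p t -> t%:R \is a @GRing.unit R.
Proof.
move=> cpt; have [Zp [A [f [g [_ [urA _] _]]]]] := R_ur.
by rewrite -(rmorph_nat g) rmorph_unit // (unramified_ext_coprime_unit urA).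
Qed.

Lemma ur_char0 n : (0 < n)%N -> n%:R != 0 :> R.
Proof.
move=> n0; have [Zp [A [f [g [cZ [urA _] [_ _ refl_g _]]]]]] := R_ur.
have [_ _ pN _] := urA; have [t cpt ->] := pfactor_coprime p_prime n0.
rewrite natrM mulf_neq0 //.
  by apply: contraTneq (ur_coprime_unit cpt) => ->; rewrite unitr0.
rewrite natrX expf_neq0 //; apply/eqP => pR0.
(* Reflecting p = 0 modulo p^2 gives p = p^2 z in A; cancelling p would then make it a unit of A. *)
have [|z] := refl_g 2 p%:R; first by rewrite rmorph_nat pR0; apply: eqmodp_refl.
rewrite subr0 expr2 -mulrA -{1}[p%:R]mulr1.
move=> /(mulfI (unramified_ext_char0 cZ urA p_gt0)).
by move=> pz; case/negP: pN; apply/unitrPr; exists z.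
Qed.

Lemma ur_eqmodp_unit x : x \is a @GRing.unit R -> ~ eqmodp p 1 x 0.
Proof.
move=> xU [z]; rewrite subr0 expr1 => xE.
have [Zp [A [f [g [_ [[_ _ pN _] _] [_ _ refl_g _]]]]]] := R_ur.
have [|y] := refl_g 1 1.
  by exists (z / x); rewrite rmorph1 subr0 mulrA expr1 -xE divrr.
by rewrite subr0 expr1 => pE; case/negP: pN; apply/unitrPr; exists y.
Qed.

(** The inverse is the sum of the geometric series of ratio -p z. *)
Lemma ur_unit1D z : 1 + p%:R * z \is a @GRing.unit R.
Proof.
pose s N : R := \sum_(i < N) (- (p%:R * z)) ^+ i.
have sE N : (1 + p%:R * z) * s N = 1 - (- (p%:R * z)) ^+ N.
  by have := subrX1 (- (p%:R * z)) N; rewrite -/(s N) => E; rewrite -opprB E; ring.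
have powE N : eqmodp p N ((- (p%:R * z)) ^+ N) 0.
  by rewrite -mulrN exprMn; apply: eqmodp_mulX.
have [l sl] : exists l, padic_cvg p s l.
  apply/ur_complete/padic_cauchyS => n; exists n => N nN.
  rewrite /s big_ord_recr -eqmodp_subr0 addrC addKr.
  exact: eqmodp_leq nN (powE N).
apply/unitrPr; exists l; apply/eqP; rewrite -subr_eq0; apply/eqP/ur_separated => n.
rewrite eqmodp_subr0; have [N cvN] := sl n.
apply: eqmodp_trans (eqmodpMl _ (eqmodp_sym (cvN (maxn N n) (leq_maxl _ _)))) _.
rewrite sE -eqmodp_subr0 addrC addKr -oppr0; apply: eqmodpN.
exact: eqmodp_leq (leq_maxr N n) (powE _).
Qed.

(** Modulo p, x comes from an element of A that is invertible there; then x is the image of that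
    element times some 1 + p t. *)
Lemma ur_local x : ~ eqmodp p 1 x 0 -> x \is a @GRing.unit R.
Proof.
move=> x0; have [Zp [A [f [g [_ [[_ _ _ loc] _] [_ _ _ surj_g]]]]]] := R_ur.
have [a xa] := surj_g 1%N x; have gU : g a \is a GRing.unit.
  apply/rmorph_unit/loc => a0; apply: x0; apply: eqmodp_trans xa _.
  by rewrite -(rmorph0 g); apply: eqmodp_rmorph.
case: xa => z /eqP; rewrite subr_eq expr1 => /eqP ->.
have -> : p%:R * z + g a = g a * (1 + p%:R * (z / g a)).
  by rewrite mulrDr mulr1 addrC mulrCA [g a * _]mulrC divrK.
by rewrite unitrM gU ur_unit1D.
Qed.

(** Modulo p, x comes from an integral element a, whose powers are combinations of 1, a, ...,
    a^(d-1) with coefficients among 0, ..., p-1. These are finite in number, so two of the powers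
    x^(p^i) agree by the pigeonhole principle. *)
Lemma ur_residue_periodic (x : R) :
  exists i j : nat, (i < j)%N /\ eqmodp p 1 (x ^+ (p ^ i)) (x ^+ (p ^ j)).
Proof.
have [Zp [A [f [g [[_ _ _ surj_int] [[_ intf _ _] _] [_ _ _ surj_g]]]]]] := R_ur.
have [a xa] := surj_g 1%N x; have [P P_monic Pa] := intf a.
have intP (c : Zp) : exists k : 'I_p, eqmodp p 1 c (k : nat)%:R.
  have [y cy] := surj_int 1%N c.
  have ylt : (`|(y %% p)%Z| < p)%N.
    by rewrite -ltz_nat gez0_abs ?modz_ge0 ?ltz_pmod // ?eqz_nat -?lt0n.
  exists (Ordinal ylt) => /=; apply: eqmodp_trans cy _.
  have yE : y%:~R = (y %/ p)%Z%:~R * p%:R + `|(y %% p)%Z|%:R :> Zp.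
    rewrite {1}(divz_eq y p) intrD intrM; congr (_ + _).
    by rewrite -[in LHS](gez0_abs (modz_ge0 y _)) // eqz_nat -lt0n.
  by exists (y %/ p)%Z%:~R; rewrite yE addrK expr1 mulrC.
pose d := (size P).-1.
have redE i : exists T : {ffun 'I_d -> 'I_p},
    eqmodp p 1 (a ^+ i) (\sum_(k < d) (T k : nat)%:R * a ^+ k).
  have P_neq0 := monic_neq0 P_monic; pose r := Pdiv.Ring.rmodp 'X^i P.
  have szr : (size (map_poly f r) <= d)%N.
    have := Pdiv.Ring.ltn_rmodpN0 'X^i P_neq0; rewrite -/r /d.
    move=> rP; apply: leq_trans (size_poly _ _) _.
    by case: (size P) rP.
  have aE : a ^+ i = \sum_(k < d) f r`_k * a ^+ k.
    transitivity (map_poly f 'X^i).[a]; first by rewrite map_polyXn hornerXn.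
    rewrite (Pdiv.RingMonic.rdivp_eq P_monic 'X^i) -/r rmorphD rmorphM hornerD hornerM.
    rewrite (eqP Pa) mulr0 add0r (horner_coef_wide a szr).
    by apply: eq_bigr => k _; rewrite coef_map.
  have [T TE] := choice (fun k : 'I_d => intP r`_k).
  exists (finfun T); rewrite aE; apply: eqmodp_sum => k _; rewrite ffunE.
  apply: eqmodpM; last exact: eqmodp_refl.
  by rewrite -(rmorph_nat f); apply: eqmodp_rmorph.
have [T TE] := choice (fun i => redE (p ^ i)%N).
pose F (i : 'I_#|{ffun 'I_d -> 'I_p}|.+1) := T i.
have [i [j ij Fij]] : exists i, exists2 j, i != j & F i = F j.
  apply/injectivePn/negP => /injectiveP/leq_card.
  by rewrite card_ord ltnn.
have per (k l : nat) : T k = T l -> eqmodp p 1 (x ^+ (p ^ k)) (x ^+ (p ^ l)).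
  move=> Tkl; apply: eqmodp_trans (eqmodpX _ xa) _; apply: eqmodp_sym.
  apply: eqmodp_trans (eqmodpX _ xa) _; rewrite -!rmorphXn; apply: eqmodp_rmorph.
  by apply: eqmodp_trans (TE l) _; rewrite -Tkl; apply: eqmodp_sym.
have [lt_ij|lt_ji|/val_inj ijE] := ltngtP i j.
- by exists i, j; split=> //; apply: per.
- by exists j, i; split=> //; apply: per.
- by rewrite ijE eqxx in ij.
Qed.

Variable phi : {rmorphism R -> R}.
Hypothesis phi_frob : is_frobenius_lift p phi.

(** Bijectivity of [phi] lets the first i Frobenius steps be cancelled, so that an eventual period
    becomes a period of x itself. *)
Lemma frobenius_lift_periodic (x : R) :
  exists2 r, (0 < r)%N & eqmodp p 1 (x ^+ (p ^ r)) x.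
Proof.
have [[psi phiK psiK] frob] := phi_frob.
have iterE i y : eqmodp p 1 (iter i phi y) (y ^+ (p ^ i)).
  elim: i => [|i IHi]; first exact: eqmodp_refl.
  by apply: eqmodp_trans (frob _) _; rewrite expnSr exprM; apply: eqmodpX.
have phi_cancel i y z : eqmodp p 1 (iter i phi y) (iter i phi z) -> eqmodp p 1 y z.
  elim: i => // i IHi /= [w wE]; apply: IHi; exists (psi w).
  by apply: (can_inj phiK); rewrite rmorphB wE rmorphM rmorphXn rmorph_nat psiK.
have [i [j [ij xij]]] := ur_residue_periodic x.
exists (j - i)%N; first by rewrite subn_gt0.
apply: eqmodp_trans (eqmodp_sym (iterE _ _)) _; apply: (phi_cancel i).
rewrite -iterD subnKC 1?ltnW //; apply: eqmodp_trans (iterE _ _) _.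
by apply: eqmodp_trans (eqmodp_sym xij) _; apply/eqmodp_sym.
Qed.

(** If x^(p^r) = x modulo p, the powers x^(p^(r k)) converge; their limit is fixed by raising to the
    power p^r, hence is a root of unity of order dividing p^r - 1. *)
Lemma teichmuller_exists (x : R) : x \is a GRing.unit ->
  exists2 z, roots_of_unity z & eqmodp p 1 z x.
Proof.
move=> xU; have [r r0 xr] := frobenius_lift_periodic x.
pose a k := x ^+ (p ^ (r * k)).
have aS k : a k.+1 = a k ^+ (p ^ r) by rewrite /a -exprM -expnD mulnS addnC.
have a_near k : eqmodp p k.+1 (a k.+1) (a k).
  rewrite /a mulnS expnD exprM; apply: eqmodp_leq (eqmodp_exppn (r * k) p_gt0 _ xr) => //.
  by rewrite add1n ltnS leq_pmull.
have ax k : eqmodp p 1 (a k) x.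
  elim: k => [|k IHk]; first by rewrite /a muln0; apply: eqmodp_refl.
  by apply: eqmodp_trans (eqmodp_leq _ (a_near k)) IHk.
have [z az] : exists z, padic_cvg p a z.
  apply/ur_complete/padic_cauchyS => n; exists n => k nk.
  by apply: eqmodp_leq (a_near k); rewrite leqW.
have zx : eqmodp p 1 z x.
  have [N cvN] := az 1%N.
  exact: eqmodp_trans (eqmodp_sym (cvN N (leqnn N))) (ax N).
have zE : z ^+ (p ^ r) = z.
  apply: (padic_cvg_unique ur_separated _ az) => n; have [N cvN] := az n.
  exists N.+1 => -[//|k] Nk; rewrite aS; apply: eqmodpX; exact: cvN.
exists z => //; exists (p ^ r).-1.
  by rewrite -ltnS prednK ?expn_gt0 ?p_gt0 // -(expn0 p) ltn_exp2l ?prime_gt1.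
have z_neq0 : z != 0.
  apply/eqP => z0; apply: (ur_eqmodp_unit xU); apply: eqmodp_sym.
  by rewrite -z0.
apply/unity_rootP; apply: (mulIf z_neq0).
by rewrite mul1r -exprSr prednK ?expn_gt0 ?p_gt0.
Qed.

Hypothesis p_neq2 : p <> 2%N.

(** Write n = t p^v with t prime to p. If (1 + p x)^p = 1 with p odd, then p^2 x (1 + p ...) = 0 and
    x = 0; repeating this removes p^v. For the exponent t the linear term, with its invertible
    factor t, gives the same conclusion. *)
Lemma unity_root_eq1 (w : R) n : (0 < n)%N -> w ^+ n = 1 -> eqmodp p 1 w 1 -> w = 1.
Proof.
move=> n0 wn w1; have [t cpt nE] := pfactor_coprime p_prime n0.
have unit1 (x : R) : 1 + p%:R * x != 0 :> R.
  by apply: contraTneq (ur_unit1D x) => ->; rewrite unitr0.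
have proot (y : R) : y ^+ p = 1 -> eqmodp p 1 y 1 -> y = 1.
  move=> yp [x xE]; have yE : y = 1 + p%:R * x by rewrite -[LHS](subrK 1) xE expr1 addrC.
  have [s sE] := expr1D_order3 (p%:R * x) p; move: sE; rewrite -yE yp.
  have /dvdnP[c ->] : (p %| 'C(p, 2))%N.
    by apply: prime_dvd_bin => //=; have := prime_gt1 p_prime; lia.
  move=> E; have : p%:R * p%:R * x * (1 + p%:R * (c%:R * x + x ^+ 2 * s)) = 0 :> R.
    apply: (addrI 1); rewrite addr0 [RHS]E natrM; ring.
  move/eqP; rewrite !mulf_eq0 (negPf (ur_char0 p_gt0)) (negPf (unit1 _)) /= orbF.
  by move=> /eqP x0; rewrite yE x0 mulr0 addr0.
have wt1 : w ^+ t = 1.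
  have wt : eqmodp p 1 (w ^+ t) 1 by rewrite -(expr1n _ t); apply: eqmodpX.
  move: wn; rewrite nE exprM; elim: (logn p n) (w ^+ t) wt => // v IHv y y1.
  rewrite expnS exprM => yv; apply: proot => //; apply: IHv => //.
  by rewrite -(expr1n _ p); apply: eqmodpX.
have t0 : (0 < t)%N.
  by rewrite lt0n; apply: contraTneq n0 => t0; rewrite nE t0 mul0n.
have [x xE] := w1; have wE : w = 1 + p%:R * x by rewrite -[LHS](subrK 1) xE expr1 addrC.
have [s] := exprD_order2 1 (p%:R * x) t.-1; rewrite prednK // -wE wt1 !expr1n mulr1.
rewrite -addrA -[X in X = _]addr0 => /addrI/esym E.
have tU := ur_coprime_unit cpt.
have : p%:R * x * (t%:R * (1 + p%:R * (x * s / t%:R))) = 0 :> R.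
  by rewrite -{}E -{2}(divrK tU s); ring.
move/eqP; rewrite !mulf_eq0 (negPf (ur_char0 p_gt0)) (negPf (ur_char0 t0)).
rewrite (negPf (unit1 _)) /= orbF => /eqP x0.
by rewrite wE x0 mulr0 addr0.
Qed.

Lemma teichmuller_unique (z1 z2 : R) : roots_of_unity z1 -> roots_of_unity z2 ->
  eqmodp p 1 z1 z2 -> z1 = z2.
Proof.
move=> [n n0 /unity_rootP zn1] [m m0 /unity_rootP zm2] z12.
have z2U : z2 \is a GRing.unit by rewrite -(unitrX_pos _ m0) zm2 unitr1.
rewrite -[z1](divrK z2U) (@unity_root_eq1 (z1 / z2) (n * m)) ?mul1r ?muln_gt0 ?n0 //.
  by rewrite expr_div_n exprM zn1 mulnC exprM zm2 !expr1n divr1.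
by rewrite -(divrr z2U); apply: eqmodpM => //; apply: eqmodp_refl.
Qed.

End UnramifiedRing.

(** * Application to the characters of the multiplicative group *)

Section MainResult.
Variables (p : nat) (R : idomainType) (phi : {rmorphism R -> R}).
Hypotheses (p_prime : prime p) (p_neq2 : p <> 2%N).
Hypotheses (R_ur : is_completed_max_unramified p R) (phi_frob : is_frobenius_lift p phi).
Variables (nu : {poly {poly R}}) (lam : {poly R}).
Let R_sep := ur_separated R_ur.
Let R_compl := ur_complete R_ur.
Let R_char0 := ur_char0 p_prime R_ur.
Let p_gt0 : (0 < p)%N := prime_gt0 p_prime.
Let p_gt2 : (2 < p)%N.
Proof. by have := prime_gt1 p_prime; lia. Qed.

Lemma char_poly_mE x : (char_poly_m p nu lam).[0, x] = (nu`_0).[x] * x - lam`_0.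
Proof.
rewrite /char_poly_m hornerD !hornerM !horner_comp !hornerM !hornerX !mulr0.
rewrite [nu.[0]]horner_coef0 [lam^:P.[0]]horner_coef0 coef_map !hornerE.
by ring.
Qed.

(** For p dividing n, mu(0, n) is congruent to mu(0, 0) modulo p, and invertibility in R is decided
    modulo p. *)
Lemma char_value_unit n : nondegenerate_char p nu lam -> (p %| n)%N ->
  char_value nu lam n \is a GRing.unit.
Proof.
rewrite /nondegenerate_char char_poly_mE mulr0 sub0r => lamU /dvdnP[k ->].
apply: (ur_local R_ur) => chi0; apply: (ur_eqmodp_unit R_ur lamU).
apply: eqmodp_trans chi0; exists (- ((nu`_0).[(k * p)%:R] * k%:R)).
by rewrite /char_value natrM; ring.
Qed.

Lemma U1_log_kernel u :
  U1 p phi nu lam u <-> log_kernel p phi (psi_p p phi) nu lam u.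
Proof. by rewrite /U1 /log_kernel /log_character -op_lambdaE. Qed.

Section AbstractLogarithm.
Variable psip : fps R -> fps R.
Hypothesis psip0 : forall u : fps R, u 0%N = 1 -> psip u 0%N = 0.
Hypothesis d_psip : forall u : fps R, u 0%N = 1 ->
  fps_deltaq (psip u) = fps_phip p phi (psi_q u) - psi_q u.

(** The filtered bijection is applied with coordinate u_kappa, [m] = kappa n and [d] = c^kappa. *)
Lemma log_kernel_eval_unique kappa n (q0 c g : R) : nondegenerate_char p nu lam ->
  pos_char_integers p nu lam = [set kappa%:Z]%classic ->
  (0 < n)%N -> c \is a GRing.unit -> q0 = p%:R ^+ n * c ->
  eqmodp p (kappa * n) g 1 ->
  exists! u : fps R, log_kernel p phi psip nu lam u /\ fps_eval p u q0 = g.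
Proof.
move=> nondeg poskappa n0 cU q0E g1.
have char_intE (k : nat) :
    pos_char_integers p nu lam k%:Z <-> char_value nu lam k = 0 /\ (0 < k)%N.
  by rewrite /pos_char_integers /char_integers /= char_poly_mE -pmulrn ltz_nat.
have [char_kappa kappa_gt0] : char_value nu lam kappa = 0 /\ (0 < kappa)%N.
  by apply/char_intE; rewrite poskappa.
have char_neq0 k : (0 < k)%N -> k <> kappa -> char_value nu lam k != 0.
  move=> k0 k_neq; apply/eqP => chk; apply: k_neq.
  have : pos_char_integers p nu lam k%:Z by apply/char_intE.
  by rewrite poskappa => -[].
have char_unit k : (0 < k)%N -> (p %| k)%N -> char_value nu lam k \is a GRing.unit.
  by move=> _; apply: char_value_unit.
pose U := log_kernel p phi psip nu lam.
have U_unit u : U u -> u \is a GRing.unit by case=> u0 _; apply: fps_inv_exists.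
have U_1 : U 1 := log_kernel_1 R_char0 psip0 d_psip nu lam.
have U_M u v : U u -> U v -> U (u * v).
  exact: (log_kernelM R_char0 psip0 d_psip).
have U_V u : U u -> U u^-1 by exact: (log_kernelV R_char0 psip0 d_psip).
have U_inj u v : U u -> U v -> u kappa = v kappa -> u = v.
  exact: (log_kernel_inj p_prime R_char0 psip0 d_psip char_neq0).
have U_surj x : exists2 u, U u & u kappa = x.
  exact: (log_kernel_surj p_prime R_char0 psip0 d_psip kappa_gt0 char_kappa).
have U_coefM u v : U u -> U v -> (u * v) kappa = u kappa + v kappa.
  exact: (log_kernel_coef_kappaM p_prime R_char0 psip0 d_psip kappa_gt0 char_neq0).
have ev1 : fps_eval p 1 q0 = 1 := fps_evalC R_sep 1 q0.
have evM u v := fps_evalM R_sep R_compl u v n0 q0E.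
have cK : c ^+ kappa \is a GRing.unit by rewrite unitrX.
have m0 : (0 < kappa * n)%N by rewrite muln_gt0 kappa_gt0.
have lead u : U u -> eqmodp p (kappa * n).+1 (fps_eval p u q0)
    (1 + p%:R ^+ (kappa * n) * (c ^+ kappa * u kappa)).
  move=> Uu; have [u0 _] := Uu; apply: fps_eval_leading => //.
  exact: (log_kernel_coef_lt_kappa p_prime R_char0 psip0 d_psip char_neq0 Uu).
have [u Uu ug] := filtered_surj p_prime p_neq2 R_sep R_compl U_unit U_1 U_M U_V U_coefM
  U_inj U_surj ev1 evM m0 cK lead g1.
exists u; split=> // v [Uv vg].
apply: (filtered_inj p_prime p_neq2 R_sep (R_char0 p_gt0) U_unit U_1 U_M U_V U_coefM
  U_inj U_surj ev1 evM m0 cK lead Uu Uv).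
by rewrite ug vg.
Qed.

End AbstractLogarithm.

Lemma U1_eval_unique kappa n (q0 c g : R) : nondegenerate_char p nu lam ->
  pos_char_integers p nu lam = [set kappa%:Z]%classic ->
  (0 < n)%N -> c \is a GRing.unit -> q0 = p%:R ^+ n * c ->
  eqmodp p (kappa * n) g 1 ->
  exists! u : fps R, U1 p phi nu lam u /\ fps_eval p u q0 = g.
Proof.
move=> nondeg poskappa n0 cU q0E g1; have frob := phi_frob.2.
have coprime_unit := ur_coprime_unit p_prime R_ur.
have psip0 := psi_p_coef0 p_prime p_gt2 R_sep R_compl R_char0 coprime_unit frob.
have d_psip := fps_deltaq_psi_p p_prime p_gt2 R_sep R_compl R_char0 coprime_unit frob.
have [u [[Uu ug] u_unique]] :=
  log_kernel_eval_unique psip0 d_psip nondeg poskappa n0 cU q0E g1.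
exists u; split; first by split=> //; apply/U1_log_kernel.
by move=> v [/U1_log_kernel Uv vg]; apply: u_unique.
Qed.

End MainResult.

Theorem corollary7p13
  (p : nat) (p_prime : prime p) (p_neq2 : p <> 2%N)
  (R : idomainType) (R_Zp_ur : is_completed_max_unramified p R)
  (phi : {rmorphism R -> R}) (phi_frob : is_frobenius_lift p phi)
  (nu : {poly {poly R}}) (lam : {poly R})
  (psi_nondeg : nondegenerate_char p nu lam) :
  (forall kappa : nat, pos_char_integers p nu lam = [set kappa%:Z]%classic ->
    forall (n : nat) (q0 g : R), (1 <= n)%N ->
      (exists2 c, c \is a GRing.unit & q0 = p%:R ^+ n * c) ->
      eqmodp p (kappa * n)%N g 1 ->
      exists! u : fps R, U1 p phi nu lam u /\ fps_eval p u q0 = g) /\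
  (pos_char_integers p nu lam = [set 1%:Z]%classic ->
    forall q0 g : R,
      (exists2 c, c \is a GRing.unit & q0 = p%:R * c) ->
      g \is a GRing.unit ->
      (exists! u : fps R, muU1 p phi nu lam u /\ fps_eval p u q0 = g) /\
      (forall u : fps R, muU1 p phi nu lam u -> fps_eval p u q0 = g ->
        unique (fun z => roots_of_unity z /\ eqmodp p 1 z (fps_eval p u q0))
          (fps_eval p u 0))).
Proof.
have U1_bij := U1_eval_unique p_prime p_neq2 R_Zp_ur phi_frob psi_nondeg.
split=> [kappa poskappa n q0 g n0 [c cU q0E] g1|pos1 q0 g [c cU q0E] gU].
  exact: U1_bij poskappa n0 cU q0E g1.
have [R_sep R_compl] := (ur_separated R_Zp_ur, ur_complete R_Zp_ur).
rewrite -[p%:R]expr1 in q0E.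
have evM (z : R) v : fps_eval p (fpsC z * v) q0 = z * fps_eval p v q0.
  by rewrite (fps_evalM R_sep R_compl _ _ (ltn0Sn 0) q0E) fps_evalC.
have U1_ev1 v : U1 p phi nu lam v -> eqmodp p 1 (fps_eval p v q0) 1.
  case=> v0 _; apply: eqmodp_trans (fps_eval_eqmodp R_compl v 1 (ltn0Sn 0) q0E) _.
  by rewrite big_ord_recl big_ord0 v0 expr0 mulr1 addr0; apply: eqmodp_refl.
(* The root of unity in a decomposition z v is thus determined by the value at [q0] modulo p. *)
have ev_near (z : R) v : U1 p phi nu lam v ->
    eqmodp p 1 z (fps_eval p (fpsC z * v) q0).
  move=> Uv; rewrite evM -{1}[z]mulr1.
  exact/eqmodpMl/eqmodp_sym/U1_ev1.
have root_inj := teichmuller_unique p_prime R_Zp_ur p_neq2.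
have root_unit (z : R) : roots_of_unity z -> z \is a GRing.unit.
  by move=> [m m0 /unity_rootP zm]; rewrite -(unitrX_pos _ m0) zm unitr1.
split; last first.
  move=> u [z [v [zroot Uv ->]]] _; have [v0 _] := Uv.
  rewrite (fps_eval_at0 R_sep) fps_coefCM v0 mulr1; split.
    by split=> //; apply: ev_near.
  move=> y [yroot yz]; apply: root_inj => //.
  exact: eqmodp_trans (ev_near z v Uv) (eqmodp_sym yz).
(* Dividing g by its Teichmuller representative reduces existence to part 1 with kappa = n = 1. *)
have [z zroot zg] := teichmuller_exists p_prime R_Zp_ur phi_frob gU.
have zU := root_unit _ zroot.
have gz1 : eqmodp p (1 * 1) (g / z) 1.
  by rewrite -(divrr zU); apply: eqmodpM; [apply: eqmodp_sym | apply: eqmodp_refl].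
have [v [[Uv vg] v_unique]] := U1_bij _ _ _ _ _ pos1 (ltn0Sn 0) cU q0E gz1.
exists (fpsC z * v); split.
  by split; [exists z, v | rewrite evM vg mulrC divrK].
move=> u [[y [w [yroot Uw ->]]] ug].
have yz : y = z.
  apply: root_inj => //; apply: eqmodp_trans (ev_near y w Uw) _.
  by rewrite ug; apply: eqmodp_sym.
rewrite yz (v_unique w) //; split=> //.
by rewrite -ug evM yz mulrC mulKr.
Qed.
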